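(* Let $(A,A^* )$ be a Hom-Lie bialgebroid over $M$ with $\varphi:M\to M$, and let $a_A^*:\varphi^!T^*M\to A^*$ and $a_{A^*}^*:\varphi^!T^*M\to A$ be the dual maps of the anchors $a_A:A\to\varphi^!TM$ and $a_{A^*}:A^*\to\varphi^!TM$. Then $\pi^\sharp:=a_A\circ a_{A^*}^*:\varphi^!T^*M\to\varphi^!TM$ defines a Hom-Poisson structure on $M$, and so does $\bar\pi^\sharp:=a_{A^*}\circ a_A^*:\varphi^!T^*M\to\varphi^!TM$. Moreover, $\pi^\sharp$ and $\bar\pi^\sharp$ are opposite to one another, i.e. $\bar\pi^\sharp=-\pi^\sharp$.
   Context: Manifolds, bundles and maps are smooth; functions are real-valued. A Hom-Lie algebra $(\mathfrak g,[\cdot,\cdot],\phi)$ is a vector space with a skew-symmetric bilinear bracket and a linear map $\phi$ such that $\phi[x,y]=[\phi(x),\phi(y)]$ and $[\phi(x),[y,z]]+[\phi(y),[z,x]]+[\phi(z),[x,y]]=0$. A representation of it on $V$ with respect to $\beta\in\mathfrak{gl}(V)$ is a linear map $\rho:\mathfrak g\to\mathfrak{gl}(V)$ with $\rho(\phi(x))\circ\beta=\beta\circ\rho(x)$ and $\rho([x,y])\circ\beta=\rho(\phi(x))\circ\rho(y)-\rho(\phi(y))\circ\rho(x)$. $\varphi^*f=f\circ\varphi$. A Hom-bundle $(A\to M,\varphi,\phi_A)$ is a vector bundle with a smooth map $\varphi:M\to M$ and a linear map $\phi_A:\Gamma(A)\to\Gamma(A)$ such that $\phi_A(fx)=\varphi^*(f)\phi_A(x)$;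 it is invertible if $\varphi$ is a diffeomorphism and $\phi_A$ is invertible. $\phi_A$ extends to $\Gamma(\wedge^kA)$ by $\phi_A(x_1\wedge\cdots\wedge x_k)=\phi_A(x_1)\wedge\cdots\wedge\phi_A(x_k)$. For an invertible Hom-bundle, $(\phi_A^\dagger(\Xi))(X)=\varphi^*\big(\Xi(\phi_A^{-1}(X))\big)$ for $\Xi\in\Gamma(\wedge^kA^* )$, $X\in\Gamma(\wedge^kA)$. $\varphi^!TM$ is the pullback bundle of $TM$; a section $x$ acts on functions by $x(f)(m)=x_m(f)$, where $x_m\in T_{\varphi(m)}M$; for a diffeomorphism $\varphi$, $\Gamma(\varphi^!TM)$ is identified with linear maps $x$ on $C^\infty(M)$ with $x(fg)=x(f)\varphi^*(g)+\varphi^*(f)x(g)$. A Hom-Lie algebroid $(A,\varphi,\phi_A,[\cdot,\cdot]_A,a_A)$ is a Hom-bundle with a Hom-Lie algebra structure $(\Gamma(A),[\cdot,\cdot]_A,\phi_A)$ and a bundle map $a_A:A\to\varphi^!TM$ such that $[x,fy]_A=\varphi^*(f)[x,y]_A+a_A(\phi_A(x))(f)\phi_A(y)$ and $a_A$ is a representation of $(\Gamma(A),[\cdot,\cdot]_A,\phi_A)$ on $C^\infty(M)$ with respect to $\varphi^*$. Its differential operator (underlying Hom-bundle invertible) is $$(\mathrm{d}\Xi)(x_1,\dots,x_{k+1})=\sum_i(-1)^{i+1}a_A(x_i)\Xi(\phi_A^{-1}(x_1),\dots,\widehat{\phi_A^{-1}(x_i)},\dots,\phi_A^{-1}(x_{k+1}))+\sum_{i<j}(-1)^{i+j}\phi_A^\dagger(\Xi)([\phi_A^{-1}(x_i),\phi_A^{-1}(x_j)]_A,x_1,\dots,\widehat{x_i},\dots,\widehat{x_j},\dots,x_{k+1}).$$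 Its Hom-Schouten bracket is, for $p,q\ge1$, $\llbracket x_1\wedge\cdots\wedge x_p,y_1\wedge\cdots\wedge y_q\rrbracket_A=\sum_{i,j}(-1)^{i+j}[x_i,y_j]_A\wedge\phi_A(x_1\wedge\cdots\widehat{x_i}\cdots\wedge x_p\wedge y_1\wedge\cdots\widehat{y_j}\cdots\wedge y_q)$. Hom-Lie bialgebroid: let $(A,\varphi,\phi_A)$ be an invertible Hom-bundle and $(A,\varphi,\phi_A,[\cdot,\cdot]_A,a_A)$, $(A^*,\varphi,\phi_A^\dagger,[\cdot,\cdot]_{A^*},a_{A^*})$ two Hom-Lie algebroids in duality. $(A,A^* )$ is a Hom-Lie bialgebroid if $\mathrm{d}_*[x,y]_A=\llbracket\mathrm{d}_*x,\phi_A(y)\rrbracket_A+\llbracket\phi_A(x),\mathrm{d}_*y\rrbracket_A$ for all $x,y\in\Gamma(A)$, where $\mathrm{d}_*:\Gamma(\wedge^kA)\to\Gamma(\wedge^{k+1}A)$ is the differential operator of the Hom-Lie algebroid $A^*$. Hom-Poisson structure: $\varphi^!TM$ is a Hom-Lie algebroid with $\phi=\mathrm{Ad}_{\varphi^*}$, $\mathrm{Ad}_{\varphi^*}(x)=\varphi^*\circ x\circ(\varphi^* )^{-1}$, bracket $[x,y]_{\varphi^*}=\varphi^*\circ x\circ(\varphi^* )^{-1}\circ y\circ(\varphi^* )^{-1}-\varphi^*\circ y\circ(\varphi^* )^{-1}\circ x\circ(\varphi^* )^{-1}$ and anchor $\mathrm{id}$. A Hom-Poisson tensor is $\pi\in\Gamma(\wedge^2\varphi^!TM)$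 with $\llbracket\pi,\pi\rrbracket_{\varphi^!TM}=0$ and $\mathrm{Ad}_{\varphi^*}(\pi)=\pi$. A bundle map $\pi^\sharp:\varphi^!T^*M\to\varphi^!TM$ defines a Hom-Poisson structure if $\pi(\xi,\eta):=\pi^\sharp(\xi)(\eta)$, $\xi,\eta\in\Gamma(\varphi^!T^*M)$, is skew-symmetric and is a Hom-Poisson tensor.
   Formalization: The bundle A is assumed not to have rank 1: there ∧²A = 0 makes the bialgebroid condition vacuous and the claim fails (e.g. A = Tℝ, A* = T*ℝ with anchor f dx ↦ f d/dx, φ = id, gives π(dx,dx) = 1). *)

(* Defs.v *)
From HB Require Import structures.
From mathcomp Require Import all_boot all_order all_algebra.
From mathcomp Require Import boolp classical_sets functions reals topology.
From mathcomp Require Import normedtype landau derive.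
From mathcomp Require Import ring.

Set Implicit Arguments.
Unset Strict Implicit.
Unset Printing Implicit Defensive.

Import Order.TTheory GRing.Theory Num.Theory numFieldNormedType.Exports.

Local Open Scope classical_set_scope.
Local Open Scope ring_scope.

(* f is C^0 on O when it is continuous at the points of O, and C^(k+1) when it
   is differentiable there and its partial derivatives are C^k.  Meant for open
   sets O. *)
Fixpoint Ck (R : realType) (n k : nat) (O : set 'rV[R]_n) (f : 'rV[R]_n -> R) :
    Prop :=
  if k is k'.+1 then
    (forall x, O x -> differentiable f x) /\
    (forall i : 'I_n, Ck k' O (fun x => 'D_(delta_mx 0 i) f x))
  else forall x, O x -> {for x, continuous f}.

Definition Cinfty (R : realType) (n : nat) (O : set 'rV[R]_n)
  (f : 'rV[R]_n -> R) : Prop := forall k, Ck k O f.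

Section CkTheory.
Context {R : realType}.

Lemma near_eq_continuous (V W : normedModType R) (f g : V -> W) (x : V) :
  (\forall y \near x, f y = g y) -> {for x, continuous f} -> {for x, continuous g}.
Proof.
move=> fg; rewrite /prop_for /continuous_at (nbhs_singleton fg).
by apply: cvg_trans; exact: (@near_eq_cvg _ _ (nbhs x)).
Qed.

Lemma near_eq_differentiable (V W : normedModType R) (f g : V -> W) (x : V) :
  (\forall y \near x, f y = g y) -> differentiable f x -> differentiable g x.
Proof.
move=> fg df; have fgx := nbhs_singleton fg.
rewrite (_ : g = f + (g - f)); last by rewrite addrC subrK.
apply: differentiableD => //.
have H : continuous (0 : V -> W) /\
    (g - f) \o shift x = cst ((g - f) x) + (0 : V -> W) +o_ 0 id.
  split; first by move=> y; exact: cvg_cst.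
  apply/eqaddoP => e e0; near=> h.
  have E : f (h + x) = g (h + x).
    near: h; move: fg; rewrite (near_shift 0 x)/=.
    by apply: filterS => h /=; rewrite subr0.
  rewrite /= /shift/= !fctE E fgx !subrr addr0 subr0 normr0.
  by rewrite mulr_ge0// ltW.
have E : ('d (g - f) x : V -> W) = (0 : V -> W).
  exact: (@diff_unique R _ _ (g - f) (\0%R : {linear V -> W}) x H.1 H.2).
apply/diff_locallyP; rewrite E; exact: H.
Unshelve. all: by end_near. Qed.

Lemma near_open (T : topologicalType) (O : set T) (P : T -> Prop) x :
  open O -> O x -> (forall y, O y -> P y) -> \forall y \near x, P y.
Proof. by move=> oO Ox OP; apply: filterS (open_nbhs_nbhs (conj oO Ox)). Qed.

Lemma Ck_ext n k (O : set 'rV[R]_n) f g : open O ->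
  (forall x, O x -> f x = g x) -> Ck k O f -> Ck k O g.
Proof.
move=> oO; elim: k f g => [|k IH] f g fg /=.
  move=> cf x Ox; apply: near_eq_continuous (cf x Ox).
  exact: near_open Ox fg.
move=> [df Df]; split=> [x Ox|i].
  apply: near_eq_differentiable (df x Ox).
  exact: near_open Ox fg.
apply: IH (Df i) => x Ox; apply: near_eq_derive.
exact: near_open Ox fg.
Qed.

Lemma Ck_cst n k (O : set 'rV[R]_n) (a : R) : open O -> Ck k O (fun=> a).
Proof.
move=> oO; elim: k a => [|k IH] a /=; first by move=> x _; exact: cst_continuous.
split=> [x _|i]; first exact: differentiable_cst.
by apply: Ck_ext (IH 0) => // x _; rewrite derive_cst.
Qed.

Lemma CkS n k (O : set 'rV[R]_n) f : Ck k.+1 O f -> Ck k O f.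
Proof.
elim: k f => [|k IH] f; first by move=> [df _] x Ox; exact/differentiable_continuous/df.
by move=> [df Df]; split=> // i; apply: IH; exact: Df.
Qed.

Lemma CkD n k (O : set 'rV[R]_n) f g : open O ->
  Ck k O f -> Ck k O g -> Ck k O (f \+ g).
Proof.
move=> oO; elim: k f g => [|k IH] f g /=.
  by move=> cf cg x Ox; apply: continuousD; [exact: cf|exact: cg].
move=> [df Df] [dg Dg]; split=> [x Ox|i].
  by apply: differentiableD; [exact: df|exact: dg].
apply: Ck_ext (IH _ _ (Df i) (Dg i)) => // x Ox /=.
by rewrite deriveD//; apply: diff_derivable; [exact: df|exact: dg].
Qed.

Lemma CkM n k (O : set 'rV[R]_n) f g : open O ->
  Ck k O f -> Ck k O g -> Ck k O (f \* g).
Proof.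
move=> oO; elim: k f g => [|k IH] f g /=.
  by move=> cf cg x Ox; apply: continuousM; [exact: cf|exact: cg].
move=> Cf Cg; have [df Df] := Cf; have [dg Dg] := Cg; split=> [x Ox|i].
  by apply: differentiableM; [exact: df|exact: dg].
have := CkD oO (IH _ _ (CkS Cf) (Dg i)) (IH _ _ (CkS Cg) (Df i)).
apply: Ck_ext => // x Ox /=.
by rewrite deriveM//; apply: diff_derivable; [exact: df|exact: dg].
Qed.

Lemma Ck_sum n k (O : set 'rV[R]_n) p (F : 'I_p -> 'rV[R]_n -> R) : open O ->
  (forall c, Ck k O (F c)) -> Ck k O (fun x => \sum_c F c x).
Proof.
move=> oO CF.
suff H : forall s : seq 'I_p, Ck k O (fun x => \sum_(c <- s) F c x) by exact: H.
elim=> [|c s IHs].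
  by apply: Ck_ext (Ck_cst k 0 oO) => // x _; rewrite big_nil.
by apply: Ck_ext (CkD oO (CF c) IHs) => // x _; rewrite big_cons.
Qed.

Lemma Ck_local n k (O : set 'rV[R]_n) f :
  (forall x, O x -> exists2 U : set 'rV[R]_n, U x & Ck k U f) -> Ck k O f.
Proof.
elim: k f => [|k IH] f H /=.
  by move=> x Ox; have [U Ux cf] := H x Ox; exact: cf.
split=> [x Ox|i]; first by have [U Ux [df _]] := H x Ox; exact: df.
by apply: IH => x Ox; have [U Ux [_ Df]] := H x Ox; exists U => //; exact: Df.
Qed.

Lemma Ck_sub n k (O U : set 'rV[R]_n) f : U `<=` O -> Ck k O f -> Ck k U f.
Proof. by move=> UO Cf; apply: Ck_local => x /UO Ox; exists O. Qed.

Lemma differentiable_rV n p (g : 'rV[R]_n -> 'rV[R]_p) x :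
  (forall c, differentiable (fun y => g y 0 c) x) -> differentiable g x.
Proof.
move=> dg.
have -> : g = \sum_c (fun y => (g y 0 c) *: delta_mx 0 c).
  by apply/funext => y; rewrite fct_sumE [LHS]row_sum_delta.
by apply: differentiable_sum => c; exact: differentiableZl.
Qed.

Lemma Ck_comp n p k (O : set 'rV[R]_n) (U : set 'rV[R]_p)
    (g : 'rV[R]_n -> 'rV[R]_p) (f : 'rV[R]_p -> R) :
  open O -> (forall x, O x -> U (g x)) ->
  (forall c, Cinfty O (fun x => g x 0 c)) -> Ck k U f -> Ck k O (f \o g).
Proof.
move=> oO gO Cg.
have dg x : O x -> differentiable g x.
  by move=> Ox; apply: differentiable_rV => c; have [H _] := Cg c 1%N; exact: H.
elim: k f => [|k IH] f /=.
  move=> cf x Ox; apply: continuous_comp; last exact/cf/gO.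
  exact/differentiable_continuous/dg.
move=> [df Df]; split=> [x Ox|i].
  by apply: differentiable_comp; [exact: dg|exact/df/gO].
have H c : Ck k O (fun x => 'D_(delta_mx 0 i) (fun y => g y 0 c) x
                            * 'D_(delta_mx 0 c) f (g x)).
  apply: (CkM oO (g := (fun y => 'D_(delta_mx 0 c) f y) \o g)); last exact/IH/Df.
  by have [_ H] := Cg c k.+1; exact: H.
apply: Ck_ext (Ck_sum oO H) => // x Ox; set v := delta_mx 0 i.
have dfg := df _ (gO _ Ox).
rewrite deriveE; last exact: differentiable_comp (dg x Ox) dfg.
rewrite diff_comp//=; last exact: dg.
rewrite -(deriveE v (dg x Ox)) derive_mx; last exact/diff_derivable/dg.
rewrite [X in 'd f (g x) X]row_sum_delta linear_sum.
by apply: eq_bigr => c _; rewrite linearZ/= -(deriveE _ dfg) mxE.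
Qed.

End CkTheory.

Record chart (R : realType) (n : nat) (M : topologicalType) := Chart {
  chart_dom : set M;
  chart_cod : set 'rV[R]_n;
  chart_map : M -> 'rV[R]_n;
  chart_inv : 'rV[R]_n -> M;
  chart_dom_open : open chart_dom;
  chart_cod_open : open chart_cod;
  chart_mapP : forall m, chart_dom m -> chart_cod (chart_map m);
  chart_invP : forall y, chart_cod y -> chart_dom (chart_inv y);
  chart_mapK : forall m, chart_dom m -> chart_inv (chart_map m) = m;
  chart_invK : forall y, chart_cod y -> chart_map (chart_inv y) = y;
  chart_map_cts : forall m, chart_dom m -> {for m, continuous chart_map};
  chart_inv_cts : forall y, chart_cod y -> {for y, continuous chart_inv} }.

(* The atlas need not be maximal. *)
Record manifold (R : realType) (n : nat) := Manifold {
  mcarrier :> topologicalType;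
  atlas : set (chart R n mcarrier);
  manifold_hausdorff : hausdorff_space mcarrier;
  manifold_countable : @second_countable mcarrier;
  atlas_cover : forall m, exists2 c, atlas c & chart_dom c m;
  atlas_compat : forall c d, atlas c -> atlas d -> forall i : 'I_n,
    Cinfty (chart_cod c `&` chart_inv c @^-1` chart_dom d)
           (fun y => chart_map d (chart_inv c y) 0 i) }.

Definition smooth_on (R : realType) (n : nat) (M : manifold R n) (O : set M)
    (f : M -> R) : Prop :=
  forall c, atlas c ->
    Cinfty (chart_cod c `&` chart_inv c @^-1` O) (f \o chart_inv c).

Lemma open_chart_preimage (R : realType) (n : nat) (M : topologicalType)
    (c : chart R n M) (O : set M) : open O ->
  open (chart_cod c `&` chart_inv c @^-1` O).
Proof.
move=> oO; rewrite openE => y [cy Oy]; rewrite /interior.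
apply: (@filterI _ (nbhs y)).
  by apply: open_nbhs_nbhs; split=> //; exact: chart_cod_open.
by apply: (chart_inv_cts cy); apply: open_nbhs_nbhs.
Qed.

Section SmoothOn.
Context {R : realType} {n : nat} {M : manifold R n} (O : set M) (oO : open O).

Lemma smooth_on_cst a : smooth_on O (fun=> a).
Proof. by move=> c _ k; apply: Ck_cst; exact: open_chart_preimage. Qed.

Lemma smooth_onD f g :
  smooth_on O f -> smooth_on O g -> smooth_on O (f \+ g).
Proof.
move=> sf sg c ac k; exact: (CkD (open_chart_preimage (c := c) oO) (sf c ac k) (sg c ac k)).
Qed.

Lemma smooth_onM f g :
  smooth_on O f -> smooth_on O g -> smooth_on O (f \* g).
Proof.
move=> sf sg c ac k; exact: (CkM (open_chart_preimage (c := c) oO) (sf c ac k) (sg c ac k)).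
Qed.

Lemma smooth_on_sub f : smooth_on setT f -> smooth_on O f.
Proof.
by move=> sf c ac k; apply: Ck_sub (sf c ac k) => y [cy _].
Qed.

End SmoothOn.

(* C^oo(M) *)
Record smoothfun (R : realType) (n : nat) (M : manifold R n) := SmoothFun {
  smoothfun_val :> M -> R;
  smoothfunP : smooth_on setT smoothfun_val }.

Notation "C^oo( M )" := (smoothfun M) (at level 0, format "C^oo( M )").

Section SmoothFunRing.
Context {R : realType} {n : nat} {M : manifold R n}.
Local Notation C := (C^oo(M)).

Lemma smoothfun_eq (f g : C) : f =1 g -> f = g.
Proof.
case: f g => [f sf] [g sg] /= /funext fg; subst g.
by congr SmoothFun; exact: Prop_irrelevance.
Qed.

HB.instance Definition _ := gen_eqMixin C.
HB.instance Definition _ := gen_choiceMixin C.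

Definition smoothfun_cst (a : R) : C :=
  SmoothFun (smooth_on_cst (@openT M) a).
Definition smoothfun_add (f g : C) : C :=
  SmoothFun (smooth_onD (@openT M) (smoothfunP f) (smoothfunP g)).
Definition smoothfun_mul (f g : C) : C :=
  SmoothFun (smooth_onM (@openT M) (smoothfunP f) (smoothfunP g)).
Let smooth_oppP (f : C) : smooth_on setT (\- f).
Proof.
have := smoothfunP (smoothfun_mul (smoothfun_cst (-1)) f).
by congr smooth_on; apply/funext => m; exact: mulN1r.
Qed.
Definition smoothfun_opp (f : C) : C := SmoothFun (smooth_oppP f).
Let smooth_scaleP (a : R) (f : C) : smooth_on setT (fun m => a * f m).
Proof. exact: (smoothfunP (smoothfun_mul (smoothfun_cst a) f)). Qed.
Definition smoothfun_scale (a : R) (f : C) : C :=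
  SmoothFun (smooth_scaleP a f).

Local Ltac smoothfun_tac :=
  move=> *; apply: smoothfun_eq => ? /=; rewrite /GRing.mul_fun /GRing.add_fun /=.

Let addA : associative smoothfun_add.
Proof. by smoothfun_tac; rewrite addrA. Qed.
Let addC : commutative smoothfun_add.
Proof. by smoothfun_tac; rewrite addrC. Qed.
Let add0 : left_id (smoothfun_cst 0) smoothfun_add.
Proof. by smoothfun_tac; rewrite add0r. Qed.
Let addN : left_inverse (smoothfun_cst 0) smoothfun_opp smoothfun_add.
Proof. by smoothfun_tac; rewrite addNr. Qed.
HB.instance Definition _ := GRing.isZmodule.Build C addA addC add0 addN.

Let mulA : associative smoothfun_mul.
Proof. by smoothfun_tac; rewrite mulrA. Qed.
Let mulC : commutative smoothfun_mul.
Proof. by smoothfun_tac; rewrite mulrC. Qed.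
Let mul1 : left_id (smoothfun_cst 1) smoothfun_mul.
Proof. by smoothfun_tac; rewrite mul1r. Qed.
Let mulDl : left_distributive smoothfun_mul +%R.
Proof. by smoothfun_tac; rewrite mulrDl. Qed.
(* Not an nzRingType: M may be empty. *)
HB.instance Definition _ :=
  GRing.Zmodule_isComPzRing.Build C mulA mulC mul1 mulDl.

Let scaleA a b f :
  smoothfun_scale a (smoothfun_scale b f) = smoothfun_scale (a * b) f.
Proof. by smoothfun_tac; rewrite mulrA. Qed.
Let scale1 : left_id 1 smoothfun_scale.
Proof. by smoothfun_tac; rewrite mul1r. Qed.
Let scaleDr : right_distributive smoothfun_scale +%R.
Proof. by smoothfun_tac; rewrite mulrDr. Qed.
Let scaleDl f : {morph smoothfun_scale^~ f : a b / a + b}.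
Proof. by smoothfun_tac; rewrite mulrDl. Qed.
HB.instance Definition _ :=
  GRing.Zmodule_isLmodule.Build R C scaleA scale1 scaleDr scaleDl.

Lemma smoothfun0E m : (0 : C) m = 0. Proof. by []. Qed.
Lemma smoothfun1E m : (1 : C) m = 1. Proof. by []. Qed.
Lemma smoothfunDE (f g : C) m : (f + g) m = f m + g m. Proof. by []. Qed.
Lemma smoothfunME (f g : C) m : (f * g) m = f m * g m. Proof. by []. Qed.
Lemma smoothfunZE a (f : C) m : (a *: f) m = a * f m. Proof. by []. Qed.
Lemma smoothfunNE (f : C) m : (- f) m = - f m. Proof. by []. Qed.

Definition smoothfunE :=
  (smoothfun0E, smoothfun1E, smoothfunDE, smoothfunME, smoothfunZE, smoothfunNE).

End SmoothFunRing.

Record smoothmap (R : realType) (n p : nat) (M : manifold R n)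
    (N : manifold R p) := SmoothMap {
  smoothmap_val :> M -> N;
  smoothmap_cts : continuous smoothmap_val;
  smoothmapP : forall c d, atlas c -> atlas d -> forall i : 'I_p,
    Cinfty (chart_cod c `&` chart_inv c @^-1` (smoothmap_val @^-1` chart_dom d))
           (fun y => chart_map d (smoothmap_val (chart_inv c y)) 0 i) }.

Record diffeo (R : realType) (n : nat) (M : manifold R n) := Diffeo {
  diffeo_map :> smoothmap M M;
  diffeo_inv : smoothmap M M;
  diffeoK : cancel diffeo_map diffeo_inv;
  diffeo_invK : cancel diffeo_inv diffeo_map }.

Lemma smooth_pullback (R : realType) (n p : nat) (M : manifold R n)
    (N : manifold R p) (phi : smoothmap M N) (f : N -> R) :
  smooth_on setT f -> smooth_on setT (f \o phi).
Proof.
move=> sf c ac k; apply: Ck_local => y [cy _].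
have [d ad dy] := atlas_cover (phi (chart_inv c y)).
set O := chart_cod c `&` chart_inv c @^-1` (phi @^-1` chart_dom d).
have oO : open O.
  apply: open_chart_preimage; apply: open_comp (chart_dom_open d) => x _.
  exact: smoothmap_cts.
exists O => //.
have := Ck_comp (g := fun z => chart_map d (phi (chart_inv c z))) oO _ _
  (sf d ad k).
have gO z : O z -> (chart_cod d `&` chart_inv d @^-1` setT)
    (chart_map d (phi (chart_inv c z))).
  by move=> [_ dz]; split=> //; exact: chart_mapP.
move=> /(_ gO (fun i => smoothmapP phi ac ad i)).
by apply: Ck_ext => // z [_ dz]/=; rewrite chart_mapK.
Qed.

(* phi^* *)
Definition pullback (R : realType) (n p : nat) (M : manifold R n)
    (N : manifold R p) (phi : smoothmap M N) (f : C^oo(N)) : C^oo(M) :=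
  SmoothFun (smooth_pullback phi (smoothfunP f)).

Section LinearForms.
Context {R : realType}.

Lemma linear_ext (V W : lmodType R) (f g : {linear V -> W}) : f =1 g -> f = g.
Proof.
case: f g => [f [[f1] [f2]]] [g [[g1] [g2]]] /= /funext fg; subst g.
by congr GRing.Linear.Pack; congr GRing.Linear.Class;
  [congr Algebra.isNmodMorphism.Axioms_|congr GRing.isScalable.Axioms_];
  exact: Prop_irrelevance.
Qed.

Context {V : lmodType R}.
Local Notation dV := {linear V -> R^o}.

HB.instance Definition _ := gen_eqMixin dV.
HB.instance Definition _ := gen_choiceMixin dV.

Definition lform_add (f g : dV) : dV := f \+ g.
Definition lform_opp (f : dV) : dV := \- f.
Definition lform_scale (a : R) (f : dV) : dV := a \*: f.

Local Ltac lform_tac := move=> *; apply: linear_ext => ? /=.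

Let addA : associative lform_add.
Proof. by lform_tac; rewrite addrA. Qed.
Let addC : commutative lform_add.
Proof. by lform_tac; rewrite addrC. Qed.
Let add0 : left_id (\0 : dV) lform_add.
Proof. by lform_tac; rewrite add0r. Qed.
Let addN : left_inverse (\0 : dV) lform_opp lform_add.
Proof. by lform_tac; rewrite addNr. Qed.
HB.instance Definition _ := GRing.isZmodule.Build dV addA addC add0 addN.

Let scaleA a b f : lform_scale a (lform_scale b f) = lform_scale (a * b) f.
Proof. by lform_tac; rewrite scalerA. Qed.
Let scale1 : left_id 1 lform_scale.
Proof. by lform_tac; rewrite scale1r. Qed.
Let scaleDr : right_distributive lform_scale +%R.
Proof. by lform_tac; rewrite scalerDr. Qed.
Let scaleDl f : {morph lform_scale^~ f : a b / a + b}.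
Proof. by lform_tac; rewrite scalerDl. Qed.
HB.instance Definition _ :=
  GRing.Zmodule_isLmodule.Build R dV scaleA scale1 scaleDr scaleDl.

Lemma lformDE (f g : dV) v : (f + g) v = f v + g v. Proof. by []. Qed.
Lemma lformZE a (f : dV) v : (a *: f) v = a * f v. Proof. by []. Qed.

End LinearForms.

Section Transpose.
Context {R : realType}.

Section Trans.
Context {U V : lmodType R} (f : {linear U -> V}).
Definition transpose (g : {linear V -> R^o}) : {linear U -> R^o} := g \o f.
Let transpose_linear : linear transpose.
Proof. by move=> a g h; apply: linear_ext. Qed.
HB.instance Definition _ := GRing.isLinear.Build R _ _ _ transpose
  transpose_linear.
End Trans.

(* For V of finite dimension, the inverse of the canonical map from V to its
   double dual, written in the coordinates of a basis (see bidualE). *)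
Section Bidual.
Context {V : vectType R}.
Local Notation e := (vbasis {:V}).
Definition bidual (L : {linear {linear V -> R^o} -> R^o}) : V :=
  \sum_(i < \dim {:V}) L (coord e i) *: e`_i.
Let bidual_linear : linear bidual.
Proof.
move=> a L L'; rewrite /bidual scaler_sumr -big_split; apply: eq_bigr => i _ /=.
by rewrite scalerDl scalerA.
Qed.
HB.instance Definition _ := GRing.isLinear.Build R _ _ _ bidual bidual_linear.

Lemma bidualE L (xi : {linear V -> R^o}) : xi (bidual L) = L xi.
Proof.
have E : xi = \sum_(i < \dim {:V}) xi e`_i *: (coord e i : {linear V -> R^o}).
  apply: linear_ext => v.
  have lsum (s : seq 'I_(\dim {:V})) : (\sum_(i <- s) xi e`_i *: (coord e i : {linear V -> R^o})) v
      = \sum_(i <- s) xi e`_i *: coord e i v.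
    by elim: s => [|i s IH]; rewrite ?big_nil// !big_cons lformDE IH.
  rewrite lsum {1}(coord_vbasis (memvf v)) linear_sum; apply: eq_bigr => i _.
  by rewrite linearZ; exact: mulrC.
rewrite [in RHS]E /bidual !linear_sum; apply: eq_bigr => i _.
by rewrite !linearZ; exact: mulrC.
Qed.
End Bidual.

End Transpose.

(* A family of real vector spaces over M together with its smooth sections:
   the common interface to a vector bundle A, to its dual, and to the pullbacks
   along phi of the tangent and cotangent bundles. *)
Record vfam (R : realType) (n : nat) (M : manifold R n) := VFam {
  fib :> M -> lmodType R;
  smooth_sec : (forall m, fib m) -> Prop;
  smooth_sec0 : smooth_sec (fun=> 0);
  smooth_secD : forall x y, smooth_sec x -> smooth_sec y ->
    smooth_sec (fun m => x m + y m);
  smooth_secZ : forall (f : C^oo(M)) x, smooth_sec x ->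
    smooth_sec (fun m => f m *: x m) }.

Record sect (R : realType) (n : nat) (M : manifold R n) (E : vfam M) := Sect {
  sect_val :> forall m, E m;
  sectP : smooth_sec sect_val }.

Section SectModule.
Context {R : realType} {n : nat} {M : manifold R n} {E : vfam M}.

Lemma sect_eq (x y : sect E) : (forall m, x m = y m) -> x = y.
Proof.
case: x y => [x sx] [y sy] /= xy.
have {}xy : x = y by apply: functional_extensionality_dep.
by subst y; congr Sect; exact: Prop_irrelevance.
Qed.

HB.instance Definition _ := gen_eqMixin (sect E).
HB.instance Definition _ := gen_choiceMixin (sect E).

Definition sect_zero : sect E := Sect (smooth_sec0 E).
Definition sect_add (x y : sect E) : sect E :=
  Sect (smooth_secD (sectP x) (sectP y)).

(* the C^oo(M)-module structure of the sections *)
Definition fscale (f : C^oo(M)) (x : sect E) : sect E :=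
  Sect (smooth_secZ f (sectP x)).

Definition sect_scale (a : R) (x : sect E) : sect E :=
  fscale (smoothfun_cst a) x.
Let sect_oppP (x : sect E) : smooth_sec (fun m => - x m).
Proof.
have := sectP (sect_scale (-1) x); congr smooth_sec.
by apply: functional_extensionality_dep => m; exact: scaleN1r.
Qed.
Definition sect_opp (x : sect E) : sect E := Sect (sect_oppP x).

Local Ltac sect_tac := move=> *; apply: sect_eq => ? /=.

Let addA : associative sect_add.
Proof. by sect_tac; rewrite addrA. Qed.
Let addC : commutative sect_add.
Proof. by sect_tac; rewrite addrC. Qed.
Let add0 : left_id sect_zero sect_add.
Proof. by sect_tac; rewrite add0r. Qed.
Let addN : left_inverse sect_zero sect_opp sect_add.
Proof. by sect_tac; rewrite addNr. Qed.
HB.instance Definition _ := GRing.isZmodule.Build (sect E) addA addC add0 addN.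

Let scaleA a b x : sect_scale a (sect_scale b x) = sect_scale (a * b) x.
Proof. by sect_tac; rewrite scalerA. Qed.
Let scale1 : left_id 1 sect_scale.
Proof. by sect_tac; rewrite scale1r. Qed.
Let scaleDr : right_distributive sect_scale +%R.
Proof. by sect_tac; rewrite scalerDr. Qed.
Let scaleDl x : {morph sect_scale^~ x : a b / a + b}.
Proof. by sect_tac; rewrite scalerDl. Qed.
HB.instance Definition _ :=
  GRing.Zmodule_isLmodule.Build R (sect E) scaleA scale1 scaleDr scaleDl.

Lemma sect0E m : (0 : sect E) m = 0. Proof. by []. Qed.
Lemma sectDE (x y : sect E) m : (x + y) m = x m + y m. Proof. by []. Qed.
Lemma sectZE a (x : sect E) m : (a *: x) m = a *: x m. Proof. by []. Qed.
Lemma sectNE (x : sect E) m : (- x) m = - x m. Proof. by []. Qed.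

Definition sectE := (sectNE, sect0E, sectDE, sectZE).

End SectModule.

Notation "f *s x" := (fscale f x) (at level 40, left associativity).

Section Dual.
Context {R : realType} {n : nat} {M : manifold R n} (E : vfam M).

Definition dual_smooth (xi : forall m, {linear E m -> R^o}) : Prop :=
  forall x : sect E, smooth_on setT (fun m => xi m (x m)).

Let dual_smooth0 : dual_smooth (fun=> 0).
Proof. by move=> x; exact: (smoothfunP (0 : C^oo(M))). Qed.
Let dual_smoothD xi eta : dual_smooth xi -> dual_smooth eta ->
  dual_smooth (fun m => xi m + eta m).
Proof.
move=> sxi seta x; have := smooth_onD (@openT M) (sxi x) (seta x).
by congr smooth_on; apply/funext.
Qed.
Let dual_smoothZ (f : C^oo(M)) xi : dual_smooth xi ->
  dual_smooth (fun m => f m *: xi m).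
Proof.
move=> sxi x; have := smooth_onM (@openT M) (smoothfunP f) (sxi x).
by congr smooth_on; apply/funext.
Qed.

Definition dual : vfam M := VFam dual_smooth0 dual_smoothD dual_smoothZ.

Definition pair (xi : sect dual) (x : sect E) : C^oo(M) :=
  SmoothFun (sectP xi x).

End Dual.

(* Fibrewise linear, smooth maps over the identity of M. *)
Record bundle_map (R : realType) (n : nat) (M : manifold R n) (E F : vfam M) :=
  BundleMap {
    bmap :> forall m, {linear E m -> F m};
    bmapP : forall x : sect E, smooth_sec (fun m => bmap m (x m)) }.

Definition bmap_sect (R : realType) (n : nat) (M : manifold R n) (E F : vfam M)
  (a : bundle_map E F) (x : sect E) : sect F := Sect (bmapP a x).

Record local_triv (R : realType) (n : nat) (M : manifold R n) (r : nat)
    (E : M -> vectType R) := LocalTriv {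
  triv_dom : set M;
  triv_map : forall m, {linear E m -> 'rV[R]_r};
  triv_inv : forall m, 'rV[R]_r -> E m;
  triv_dom_open : open triv_dom;
  triv_mapK : forall m, triv_dom m -> cancel (triv_map m) (triv_inv m);
  triv_invK : forall m, triv_dom m -> cancel (triv_inv m) (triv_map m) }.

(* A vector bundle of rank r, as a family of fibres with a cover by local
   trivialisations whose changes of frame are smooth. *)
Record vbundle (R : realType) (n : nat) (M : manifold R n) (r : nat) := VBundle {
  vfib : M -> vectType R;
  vatlas : set (local_triv r vfib);
  vatlas_cover : forall m, exists2 t, vatlas t & triv_dom t m;
  vatlas_compat : forall t u, vatlas t -> vatlas u ->
    forall (v : 'rV[R]_r) (i : 'I_r),
      smooth_on (triv_dom t `&` triv_dom u)
                (fun m => triv_map u m (triv_inv t m v) 0 i) }.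

Section VBundleFam.
Context {R : realType} {n : nat} {M : manifold R n} {r : nat}.
Variable A : vbundle M r.

Definition vbundle_smooth (x : forall m, vfib A m) : Prop :=
  forall t, vatlas t -> forall i : 'I_r,
    smooth_on (triv_dom t) (fun m => triv_map t m (x m) 0 i).

Let vbundle_smooth0 : vbundle_smooth (fun=> 0).
Proof.
move=> t _ i; have := smooth_on_cst (triv_dom_open t) 0.
by congr smooth_on; apply/funext => m; rewrite linear0 mxE.
Qed.
Let vbundle_smoothD x y : vbundle_smooth x -> vbundle_smooth y ->
  vbundle_smooth (fun m => x m + y m).
Proof.
move=> sx sy t vt i; have o := triv_dom_open t.
have := smooth_onD o (sx t vt i) (sy t vt i).
by congr smooth_on; apply/funext => m; rewrite linearD mxE.
Qed.
Let vbundle_smoothZ (f : C^oo(M)) x : vbundle_smooth x ->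
  vbundle_smooth (fun m => f m *: x m).
Proof.
move=> sx t vt i; have o := triv_dom_open t.
have := smooth_onM o (smooth_on_sub (triv_dom t) (smoothfunP f)) (sx t vt i).
by congr smooth_on; apply/funext => m; rewrite linearZ mxE.
Qed.

Definition vbundle_fam : vfam M :=
  VFam vbundle_smooth0 vbundle_smoothD vbundle_smoothZ.

End VBundleFam.

Coercion vbundle_fam : vbundle >-> vfam.

(* The tangent space at p, as the space of derivations at p. *)
Record tangent (R : realType) (n : nat) (M : manifold R n) (p : M) := Tangent {
  tangent_val :> C^oo(M) -> R;
  tangent_linear : forall a f g,
    tangent_val (a *: f + g) = a * tangent_val f + tangent_val g;
  tangent_leibniz : forall f g,
    tangent_val (f * g) = tangent_val f * g p + f p * tangent_val g }.

Section TangentSpace.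
Context {R : realType} {n : nat} {M : manifold R n} {p : M}.
Local Notation T := (tangent p).

Lemma tangent_eq (v w : T) : v =1 w -> v = w.
Proof.
case: v w => [v v1 v2] [w w1 w2] /= /funext vw; subst w.
by congr Tangent; exact: Prop_irrelevance.
Qed.

HB.instance Definition _ := gen_eqMixin T.
HB.instance Definition _ := gen_choiceMixin T.

Local Obligation Tactic := idtac.
Program Definition tangent_zero : T := @Tangent R n M p (fun=> 0) _ _.
Next Obligation. by move=> *; rewrite mulr0 addr0. Qed.
Next Obligation. by move=> *; rewrite mul0r mulr0 addr0. Qed.
Program Definition tangent_add (v w : T) : T :=
  @Tangent R n M p (fun f => v f + w f) _ _.
Next Obligation.
by move=> v w a f g /=; rewrite !tangent_linear mulrDr addrACA.
Qed.
Next Obligation.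
by move=> v w f g /=; rewrite !tangent_leibniz mulrDr mulrDl addrACA.
Qed.
Program Definition tangent_scale (a : R) (v : T) : T :=
  @Tangent R n M p (fun f => a * v f) _ _.
Next Obligation.
by move=> a v b f g /=; rewrite tangent_linear mulrDr mulrCA.
Qed.
Next Obligation.
by move=> a v f g /=; rewrite tangent_leibniz mulrDr mulrA mulrCA.
Qed.
Program Definition tangent_opp (v : T) : T :=
  @Tangent R n M p (fun f => - v f) _ _.
Next Obligation.
by move=> v a f g /=; rewrite tangent_linear opprD mulrN.
Qed.
Next Obligation.
by move=> v f g /=; rewrite tangent_leibniz opprD mulrN mulNr.
Qed.

Local Ltac tangent_tac :=
  move=> *; apply: tangent_eq => ? /=.

Let addA : associative tangent_add.
Proof. by tangent_tac; rewrite addrA. Qed.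
Let addC : commutative tangent_add.
Proof. by tangent_tac; rewrite addrC. Qed.
Let add0 : left_id tangent_zero tangent_add.
Proof. by tangent_tac; rewrite add0r. Qed.
Let addN : left_inverse tangent_zero tangent_opp tangent_add.
Proof. by tangent_tac; rewrite addNr. Qed.
HB.instance Definition _ := GRing.isZmodule.Build T addA addC add0 addN.

Let scaleA a b v : tangent_scale a (tangent_scale b v) = tangent_scale (a * b) v.
Proof. by tangent_tac; rewrite mulrA. Qed.
Let scale1 : left_id 1 tangent_scale.
Proof. by tangent_tac; rewrite mul1r. Qed.
Let scaleDr : right_distributive tangent_scale +%R.
Proof. by tangent_tac; rewrite mulrDr. Qed.
Let scaleDl v : {morph tangent_scale^~ v : a b / a + b}.
Proof. by tangent_tac; rewrite mulrDl. Qed.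
HB.instance Definition _ :=
  GRing.Zmodule_isLmodule.Build R T scaleA scale1 scaleDr scaleDl.

Lemma tangent0E f : (0 : T) f = 0. Proof. by []. Qed.
Lemma tangentDE (v w : T) f : (v + w) f = v f + w f.
Proof. by []. Qed.
Lemma tangentZE a (v : T) f : (a *: v) f = a * v f.
Proof. by []. Qed.
Lemma tangentNE (v : T) f : (- v) f = - v f. Proof. by []. Qed.

Definition tangentE := (tangent0E, tangentDE, tangentZE, tangentNE).

End TangentSpace.

(* The pullback phi^! TM of the tangent bundle. *)
Section PullbackTangent.
Context {R : realType} {n : nat} {M : manifold R n} (phi : smoothmap M M).

Definition ptan_smooth (x : forall m, tangent (phi m)) : Prop :=
  forall f : C^oo(M), smooth_on setT (fun m => x m f).

Let ptan_smooth0 : ptan_smooth (fun=> 0).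
Proof. by move=> f; exact: (smoothfunP (0 : C^oo(M))). Qed.
Let ptan_smoothD x y : ptan_smooth x -> ptan_smooth y ->
  ptan_smooth (fun m => x m + y m).
Proof.
move=> sx sy f; have := smooth_onD (@openT M) (sx f) (sy f).
by congr smooth_on; apply/funext => m; rewrite tangentE.
Qed.
Let ptan_smoothZ (f : C^oo(M)) x : ptan_smooth x ->
  ptan_smooth (fun m => f m *: x m).
Proof.
move=> sx g; have := smooth_onM (@openT M) (smoothfunP f) (sx g).
by congr smooth_on; apply/funext => m; rewrite tangentE.
Qed.

Definition ptan : vfam M := VFam ptan_smooth0 ptan_smoothD ptan_smoothZ.

(* x(f)(m) = x_m(f) *)
Definition act (x : sect ptan) (f : C^oo(M)) : C^oo(M) :=
  SmoothFun (sectP x f).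

Lemma actE x f m : act x f m = (x m : tangent (phi m)) f. Proof. by []. Qed.

Lemma act_eq x y : act x =1 act y -> x = y.
Proof.
move=> xy; apply: sect_eq => m; apply: tangent_eq => f.
by rewrite -!actE xy.
Qed.

Lemma act_linear x a f g : act x (a *: f + g) = a *: act x f + act x g.
Proof. by apply: smoothfun_eq => m; rewrite !smoothfunE !actE tangent_linear. Qed.

Lemma act_leibniz x f g :
  act x (f * g) = act x f * pullback phi g + pullback phi f * act x g.
Proof.
by apply: smoothfun_eq => m; rewrite !smoothfunE !actE tangent_leibniz.
Qed.

(* The identification of the sections of phi^! TM with the linear maps D on
   C^oo(M) such that D(fg) = D(f) phi^*(g) + phi^*(f) D(g). *)
Section OfDerivation.
Variable D : C^oo(M) -> C^oo(M).
Hypothesis D_linear : forall a f g, D (a *: f + g) = a *: D f + D g.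
Hypothesis D_leibniz : forall f g,
  D (f * g) = D f * pullback phi g + pullback phi f * D g.

Local Obligation Tactic := idtac.
Program Definition ptan_val (m : M) : tangent (phi m) :=
  @Tangent R n M (phi m) (fun f => D f m) _ _.
Next Obligation. by move=> m a f g /=; rewrite D_linear. Qed.
Next Obligation. by move=> m f g /=; rewrite D_leibniz. Qed.

Definition ptan_of : sect ptan :=
  @Sect R n M ptan ptan_val (fun f => smoothfunP (D f)).

Lemma act_ptan_of f : act ptan_of f = D f.
Proof. exact: smoothfun_eq. Qed.

End OfDerivation.

End PullbackTangent.

Record hom_lie_algebra (R : realType) (V : lmodType R) (br : V -> V -> V)
    (phi : V -> V) : Prop := HomLieAlgebra {
  hla_linear : linear phi;
  hla_bilinearl : forall y, linear (br^~ y);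
  hla_bilinearr : forall x, linear (br x);
  hla_skew : forall x y, br x y = - br y x;
  hla_morph : forall x y, phi (br x y) = br (phi x) (phi y);
  hla_jacobi : forall x y z,
    br (phi x) (br y z) + br (phi y) (br z x) + br (phi z) (br x y) = 0 }.

Record hom_lie_representation (R : realType) (g V : lmodType R)
    (br : g -> g -> g) (phi : g -> g) (beta : V -> V) (rho : g -> V -> V) :
    Prop := HomLieRepresentation {
  hlr_linear_beta : linear beta;
  hlr_linear : forall x, linear (rho x);
  hlr_linearl : forall v, linear (rho^~ v);
  hlr_beta : forall x v, rho (phi x) (beta v) = beta (rho x v);
  hlr_bracket : forall x y v, rho (br x y) (beta v)
    = rho (phi x) (rho y v) - rho (phi y) (rho x v) }.

Section HomStructures.
Context {R : realType} {n : nat} {M : manifold R n}.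

Record hom_bundle (E : vfam M) (phi : smoothmap M M) := HomBundle {
  hb_map :> sect E -> sect E;
  hb_linear : linear hb_map;
  hb_semilinear : forall f x, hb_map (f *s x) = pullback phi f *s hb_map x }.

Record inv_hom_bundle (E : vfam M) (phi : diffeo M) := InvHomBundle {
  ihb_map :> hom_bundle E phi;
  ihb_inv : sect E -> sect E;
  ihbK : cancel ihb_map ihb_inv;
  ihb_invK : cancel ihb_inv ihb_map }.

Record hom_lie_algebroid (E : vfam M) (phi : smoothmap M M)
    (phiE : hom_bundle E phi) := HomLieAlgebroid {
  bracket : sect E -> sect E -> sect E;
  anchor : bundle_map E (ptan phi);
  bracket_hom_lie : hom_lie_algebra bracket phiE;
  bracket_leibniz : forall x f y, bracket x (f *s y)
    = pullback phi f *s bracket x y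
      + act (bmap_sect anchor (phiE x)) f *s phiE y;
  anchor_representation : hom_lie_representation bracket phiE (pullback phi)
    (fun x => act (bmap_sect anchor x)) }.

(* The sections of /\^k E^* are the alternating C^oo(M)-multilinear maps
   Sect(E)^k -> C^oo(M), i.e., the maps satisfying is_kform.  Those of /\^k E
   are such maps on Sect(E^* )^k, since the fibres have finite dimension. *)
Definition kform (E : vfam M) (k : nat) := ('I_k -> sect E) -> C^oo(M).

Definition subst_arg (E : vfam M) k (X : 'I_k -> sect E) (i : 'I_k)
  (x : sect E) : 'I_k -> sect E := fun l => if l == i then x else X l.

Record is_kform (E : vfam M) k (Xi : kform E k) : Prop := IsKForm {
  kform_multilinear : forall X i f x y, Xi (subst_arg X i (f *s x + y))
    = f * Xi (subst_arg X i x) + Xi (subst_arg X i y);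
  kform_alternating : forall X i j, i != j -> X i = X j -> Xi X = 0 }.

Section Differential.
Context {E : vfam M} {phi : diffeo M} {phiE : inv_hom_bundle E phi}.

(* phi_E^dagger *)
Definition dagger k (Xi : kform E k) : kform E k :=
  fun X => pullback phi (Xi (fun l => ihb_inv phiE (X l))).

Definition differential (L : hom_lie_algebroid phiE) k (Xi : kform E k) :
    kform E k.+1 := fun X =>
  \sum_(i < k.+1) (-1) ^+ i * act (bmap_sect (anchor L) (X i))
                                (Xi (fun l => ihb_inv phiE (X (lift i l))))
  + \sum_(i < k.+1) \sum_(j < k.+1 | (i < j)%N) (-1) ^+ (i + j) *
      dagger Xi (fun l : 'I_k =>
        (bracket L (ihb_inv phiE (X i)) (ihb_inv phiE (X j))
          :: [seq X a | a <- enum 'I_k.+1 & (a != i) && (a != j)])`_l).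

End Differential.

Section Multivectors.
Context {E : vfam M}.

(* x_1 /\ ... /\ x_k, evaluated on xi_1, ..., xi_k at the point m *)
Definition wedge k (x : 'I_k -> sect E) (xi : 'I_k -> sect (dual E)) (m : M) :
    R := \det (\matrix_(i < k, j < k) (xi i m) (x j m)).

(* P is the sum of the decomposable multivectors s in a neighbourhood of m. *)
Definition locally_sum k (P : kform (dual E) k) (m : M)
    (s : seq ('I_k -> sect E)) : Prop :=
  \forall m' \near m, forall xi, P xi m' = \sum_(x <- s) wedge x xi m'.

Definition sect_kform (x : sect E) : kform (dual E) 1 :=
  fun xi => pair (xi ord0) x.

(* Q = phi_E(P), for the extension of phi_E to /\^k E.  At m, phi_E(P) only
   depends on P near phi(m), where P is a sum of decomposables. *)
Definition is_extension (phi : smoothmap M M) (phiE : hom_bundle E phi) k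
    (P Q : kform (dual E) k) : Prop :=
  forall m, exists2 s, locally_sum P (phi m) s &
    forall xi, Q xi m = \sum_(x <- s) wedge (phiE \o x) xi m.

Section Schouten.
Context {phi : smoothmap M M} {phiE : hom_bundle E phi}.
Variable L : hom_lie_algebroid phiE.

(* [[x_0 /\ ... /\ x_p, y_0 /\ ... /\ y_q]] *)
Definition schouten_decomposable p q (x : 'I_p.+1 -> sect E)
    (y : 'I_q.+1 -> sect E) (xi : 'I_(p + q).+1 -> sect (dual E)) (m : M) : R :=
  \sum_(i < p.+1) \sum_(j < q.+1) (-1) ^+ (i + j) *
    wedge (fun l : 'I_(p + q).+1 =>
      (bracket L (x i) (y j)
        :: [seq phiE z | z <- [seq x a | a <- enum 'I_p.+1 & a != i]
                              ++ [seq y b | b <- enum 'I_q.+1 & b != j]])`_l)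
      xi m.

(* S = [[P, Q]].  By the Leibniz rule, the value of [[P, Q]] at m only depends
   on P and Q near phi(m), where they are sums of decomposables; the bracket
   is bilinear. *)
Definition is_schouten p q (P : kform (dual E) p.+1) (Q : kform (dual E) q.+1)
    (S : kform (dual E) (p + q).+1) : Prop :=
  forall m, exists s t,
    [/\ locally_sum P (phi m) s, locally_sum Q (phi m) t &
        forall xi, S xi m =
          \sum_(x <- s) \sum_(y <- t) schouten_decomposable x y xi m].

End Schouten.

End Multivectors.

(* A ** is identified with A: the differential d_* of the Hom-Lie algebroid A^*
   maps kform (dual A) k, the sections of /\^k A, to kform (dual A) k.+1. *)
Record hom_lie_bialgebroid (r : nat) (A : vbundle M r) (phi : diffeo M)
    (phiA : inv_hom_bundle A phi) (phiAd : inv_hom_bundle (dual A) phi)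
    (LA : hom_lie_algebroid phiA) (LAd : hom_lie_algebroid phiAd) : Prop :=
  HomLieBialgebroid {
    hlb_dagger : forall (xi : sect (dual A)) (x : sect A),
      pair (phiAd xi) x = pullback phi (pair xi (ihb_inv phiA x));
    hlb_compat : forall x y : sect A, exists S T : kform (dual A) 2,
      [/\ is_schouten LA (differential LAd (sect_kform x))
                         (sect_kform (phiA y)) S,
          is_schouten LA (sect_kform (phiA x))
                         (differential LAd (sect_kform y)) T &
          forall xi, differential LAd (sect_kform (bracket LA x y)) xi
                     = S xi + T xi] }.

End HomStructures.

Section PullbackTangentAlgebroid.
Context {R : realType} {n : nat} {M : manifold R n} (phi : diffeo M).
Local Notation T := (ptan phi).
Local Notation F := (pullback phi).
Local Notation G := (pullback (diffeo_inv phi)).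

Let actZ (x : sect T) a f : act x (a *: f) = a *: act x f.
Proof.
have x0 : act x 0 = 0.
  have := act_linear x 1 0 0; rewrite !scale1r add0r => /eqP.
  by rewrite -subr_eq subrr eq_sym => /eqP.
by rewrite -[a *: f]addr0 act_linear x0 addr0.
Qed.
Let actD (x : sect T) f g : act x (f + g) = act x f + act x g.
Proof. by rewrite -[f]scale1r act_linear !scale1r. Qed.
Let actN (x : sect T) f : act x (- f) = - act x f.
Proof. by rewrite -scaleN1r actZ scaleN1r. Qed.

Let actDl (x y : sect T) f : act (x + y) f = act x f + act y f.
Proof. by apply: smoothfun_eq => m; rewrite smoothfunE !actE sectE tangentDE. Qed.
Let actZl a (x : sect T) f : act (a *: x) f = a *: act x f.
Proof. by apply: smoothfun_eq => m; rewrite smoothfunE !actE sectE tangentZE. Qed.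
Let actNl (x : sect T) f : act (- x) f = - act x f.
Proof. by rewrite -scaleN1r actZl scaleN1r. Qed.
Let actfl f (x : sect T) g : act (f *s x) g = f * act x g.
Proof. by apply: smoothfun_eq => m; rewrite smoothfunE !actE tangentZE. Qed.

Let pullbackD (psi : smoothmap M M) f g :
  pullback psi (f + g) = pullback psi f + pullback psi g.
Proof. exact: smoothfun_eq. Qed.
Let pullbackZ (psi : smoothmap M M) a f :
  pullback psi (a *: f) = a *: pullback psi f.
Proof. exact: smoothfun_eq. Qed.
Let pullbackN (psi : smoothmap M M) f : pullback psi (- f) = - pullback psi f.
Proof. exact: smoothfun_eq. Qed.
Let pullbackM (psi : smoothmap M M) f g :
  pullback psi (f * g) = pullback psi f * pullback psi g.
Proof. exact: smoothfun_eq. Qed.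
Let FG f : F (G f) = f.
Proof. by apply: smoothfun_eq => m /=; rewrite diffeoK. Qed.
Let GF f : G (F f) = f.
Proof. by apply: smoothfun_eq => m /=; rewrite diffeo_invK. Qed.

(* Ad_(phi^* ), its inverse, and the bracket of phi^! TM *)
Section Ad.
Variable x : sect T.
Let D f := F (act x (G f)).
Let D_linear a f g : D (a *: f + g) = a *: D f + D g.
Proof. by rewrite /D !(pullbackD, pullbackZ, actD, actZ). Qed.
Let D_leibniz f g : D (f * g) = D f * F g + F f * D g.
Proof. by rewrite /D pullbackM act_leibniz !FG pullbackD !pullbackM. Qed.
Definition Ad : sect T := ptan_of D_linear D_leibniz.
Lemma act_Ad f : act Ad f = F (act x (G f)).
Proof. exact: act_ptan_of. Qed.
End Ad.

Section AdInv.
Variable x : sect T.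
Let D f := G (act x (F f)).
Let D_linear a f g : D (a *: f + g) = a *: D f + D g.
Proof. by rewrite /D !(pullbackD, pullbackZ, actD, actZ). Qed.
Let D_leibniz f g : D (f * g) = D f * F g + F f * D g.
Proof. by rewrite /D pullbackM act_leibniz pullbackD !pullbackM !GF. Qed.
Definition Ad_inv : sect T := ptan_of D_linear D_leibniz.
Lemma act_Ad_inv f : act Ad_inv f = G (act x (F f)).
Proof. exact: act_ptan_of. Qed.
End AdInv.

Section Bracket.
Variables x y : sect T.
Let D f := F (act x (G (act y (G f)))) - F (act y (G (act x (G f)))).
Let D_linear a f g : D (a *: f + g) = a *: D f + D g.
Proof.
by rewrite /D !(pullbackD, pullbackZ, actD, actZ) opprD scalerBr addrACA.
Qed.
Let D_leibniz f g : D (f * g) = D f * F g + F f * D g.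
Proof.
rewrite /D !(pullbackM, act_leibniz, pullbackD, actD, FG).
rewrite mulrBl mulrBr.
set a := F (act x (G (act y (G f)))); set b := F (act y (G (act x (G f)))).
set c := F (act x (G (act y (G g)))); set d := F (act y (G (act x (G g)))).
apply: smoothfun_eq => m; rewrite !smoothfunE; ring.
Qed.
Definition ptan_bracket : sect T := ptan_of D_linear D_leibniz.
Lemma act_bracket f : act ptan_bracket f
  = F (act x (G (act y (G f)))) - F (act y (G (act x (G f)))).
Proof. exact: act_ptan_of. Qed.
End Bracket.

Let Ad_linear : linear Ad.
Proof.
move=> a x y; apply: act_eq => f.
by rewrite !(act_Ad, actDl, actZl, pullbackD, pullbackZ).
Qed.
Let Ad_semilinear f x : Ad (f *s x) = F f *s Ad x.
Proof. by apply: act_eq => g; rewrite !(act_Ad, actfl, pullbackM). Qed.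

Definition ptan_hom : hom_bundle T phi := HomBundle Ad_linear Ad_semilinear.

Let AdK : cancel ptan_hom Ad_inv.
Proof. by move=> x; apply: act_eq => f; rewrite act_Ad_inv act_Ad !GF. Qed.
Let Ad_invK : cancel Ad_inv ptan_hom.
Proof. by move=> x; apply: act_eq => f; rewrite act_Ad act_Ad_inv !FG. Qed.

Definition ptan_inv_hom : inv_hom_bundle T phi := InvHomBundle AdK Ad_invK.

Local Notation simp := (act_Ad, act_bracket, actDl, actZl, actNl, actfl,
  pullbackD, pullbackZ, pullbackN, pullbackM, actD, actZ, actN, act_leibniz,
  FG, GF).

Let ptan_hom_lie : hom_lie_algebra ptan_bracket ptan_hom.
Proof.
split.
- exact: Ad_linear.
- move=> y a x x'; apply: act_eq => f; rewrite !simp.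
  by rewrite opprD scalerBr addrACA.
- move=> x a y y'; apply: act_eq => f; rewrite !simp.
  by rewrite opprD scalerBr addrACA.
- by move=> x y; apply: act_eq => f; rewrite !simp opprB.
- by move=> x y; apply: act_eq => f; rewrite !simp.
- move=> x y z; apply: act_eq => f; rewrite !simp.
  apply: smoothfun_eq => m; rewrite actE sectE tangentE !smoothfunE; ring.
Qed.

Let id_bundle_map : bundle_map T T :=
  @BundleMap R n M T T (fun m => idfun) (fun x => sectP x).

Let act_id x : act (bmap_sect id_bundle_map x) = act x.
Proof. by congr act; exact: sect_eq. Qed.

Let ptan_leibniz x f y : ptan_bracket x (f *s y)
  = F f *s ptan_bracket x y
    + act (bmap_sect id_bundle_map (ptan_hom x)) f *s ptan_hom y.
Proof.
apply: act_eq => g; rewrite act_id !simp.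
apply: smoothfun_eq => m; rewrite !smoothfunE; ring.
Qed.

Let ptan_representation : hom_lie_representation ptan_bracket ptan_hom F
  (fun x => act (bmap_sect id_bundle_map x)).
Proof.
split=> [a f g|x a f g|f a x y|x f|x y f]; rewrite /= ?act_id ?simp//.
Qed.

Definition ptan_algebroid : hom_lie_algebroid ptan_inv_hom :=
  HomLieAlgebroid ptan_hom_lie ptan_leibniz ptan_representation.

Record hom_poisson_tensor (pi : kform (dual T) 2) : Prop := HomPoissonTensor {
  hpt_form : is_kform pi;
  hpt_schouten : is_schouten ptan_algebroid pi pi (fun=> 0);
  hpt_Ad : is_extension ptan_inv_hom pi pi }.

(* pis : phi^! T^* M -> phi^! TM.  As pi takes values in C^oo(M), its existence
   forces pis to map smooth sections to smooth sections. *)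
Definition defines_hom_poisson
    (pis : forall m, {linear dual T m -> T m}) : Prop :=
  exists2 pi : kform (dual T) 2,
    forall xi m, pi xi m = (xi ord_max m) (pis m (xi ord0 m)) &
    hom_poisson_tensor pi.

End PullbackTangentAlgebroid.

Section DualAnchors.
Context {R : realType} {n : nat} {M : manifold R n} {r : nat}.
Context {A : vbundle M r} {phi : diffeo M}.
Context {phiA : inv_hom_bundle A phi} {phiAd : inv_hom_bundle (dual A) phi}.
Variables (LA : hom_lie_algebroid phiA) (LAd : hom_lie_algebroid phiAd).

(* a_A^* : phi^! T^* M -> A^* *)
Definition dual_anchor (m : M) :
    {linear dual (ptan phi) m -> dual A m} :=
  transpose (anchor LA m).

(* a_(A^* )^* : phi^! T^* M -> A ** = A *)
Definition dual_anchor_dual (m : M) : {linear dual (ptan phi) m -> A m} :=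
  bidual (V := vfib A m) \o transpose (anchor LAd m).

Definition pi_sharp (m : M) : {linear dual (ptan phi) m -> ptan phi m} :=
  anchor LA m \o dual_anchor_dual m.

Definition pi_bar_sharp (m : M) : {linear dual (ptan phi) m -> ptan phi m} :=
  anchor LAd m \o dual_anchor m.

End DualAnchors.

(* Main.v *)
(* Write {f,g} = a_A(d_* f)(g), which is pi(df,dg).  Comparing the compatibility
   condition for (x, f y) with the one for (x, y), all terms cancel except
     u /\ phi_A^2(y) = 0,
     u = d_*(a_A(phi_A x) f) - [phi_A x, d_* f] - phi_A(d_* x(-, df));
   contracting over a local frame gives (r - 1) u = 0, so u = 0 as r <> 1.  In
   u = 0, replacing x by g x leaves {f,g} + {g,f} = 0, which is also
   a_(A^* )(df) = - a_A(d_* f); and x = d_* g, with d_* d_* = 0, gives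
   d_*{g,f} = [d_* g, d_* f], whose image under the anchor is the Jacobi identity.
   A covector of M is only ever evaluated on finitely many vectors, on which it
   coincides with the differential of a function; so these identities between
   functions determine pi and [[pi, pi]].  The Hom-Schouten bracket is defined
   by local decompositions: it is made intrinsic through the Hom-Lie derivative of
   sections of A^*, which exists by tensoriality. *)

From HB Require Import structures.
Require Import Defs.
From mathcomp Require Import all_boot all_order all_algebra.
From mathcomp Require Import boolp classical_sets functions reals topology.
From mathcomp Require Import normedtype derive realfun sequences exp.
From mathcomp Require Import ring lra.

Set Implicit Arguments.
Unset Strict Implicit.
Unset Printing Implicit Defensive.

Import Order.TTheory GRing.Theory Num.Theory numFieldNormedType.Exports.

Local Open Scope classical_set_scope.
Local Open Scope ring_scope.

(** * Bump functions *)

Section Flat.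
Context {R : realType}.
Implicit Types (t : R) (k : nat).

(* The factor t^(-k) makes this family of flat functions stable under
   differentiation. *)
Definition flat k t : R := if 0 < t then t^-1 ^+ k * expR (- t^-1) else 0.

Lemma flat_ge0 k t : 0 <= flat k t.
Proof.
rewrite /flat; case: ifP => // t0.
by rewrite mulr_ge0 ?expR_ge0// exprn_ge0// invr_ge0 ltW.
Qed.

Lemma flat_gt0 k t : 0 < t -> 0 < flat k t.
Proof. by rewrite /flat => t0; rewrite t0 mulr_gt0 ?expR_gt0// exprn_gt0// invr_gt0. Qed.

Lemma flat_le0 k t : t <= 0 -> flat k t = 0.
Proof. by rewrite /flat ltNge => ->. Qed.

(** The term of order k + 2 in the exponential series at [t^-1] bounds [expR t^-1] from below; its
    two orders beyond the prefactor leave t^2. *)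
Lemma flat_le_sqr k t : `|flat k t| <= (k.+2)`!%:R * `|t| ^+ 2.
Proof.
rewrite (ger0_norm (flat_ge0 _ _)) /flat; case: ifP => [t0|_]; last first.
  by rewrite mulr_ge0// exprn_ge0.
rewrite (gtr0_norm t0) expRN -[in leRHS](invrK t).
set s := t^-1; have s0 : 0 < s by rewrite invr_gt0.
have N0 : k.+2`!%:R != 0 :> R by rewrite pnatr_eq0 -lt0n fact_gt0.
rewrite ler_pdivrMr ?expR_gt0//.
have /(ler_wpM2l (_ : 0 <= k.+2`!%:R * s^-1 ^+ 2)) : s ^+ k.+2 / k.+2`!%:R <= expR s.
  by apply: le_trans (expR_ge1Dxn k.+1 (ltW s0)); rewrite lerDr.
move=> /(_ (mulr_ge0 (ler0n _ _) (exprn_ge0 _ (ltW _)))); rewrite invr_gt0 => /(_ s0).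
apply: le_trans; rewrite le_eqVlt; apply/orP; left; apply/eqP.
by rewrite !exprS !expr0; field; rewrite N0 gt_eqF.
Qed.

Lemma flat_is_derive k t :
  is_derive t 1 (flat k) (flat k.+2 t - k%:R * flat k.+1 t).
Proof.
have [t0|t0|->] := ltgtP t 0.
- rewrite !flat_le0 ?(ltW t0)// mulr0 subr0.
  apply: (@near_eq_is_derive _ _ _ (cst (0 : R))).
  by near=> u; rewrite flat_le0// ltW//; near: u; exact: lt_nbhsl.
- have dV := is_deriveV (f := id) (lt0r_neq0 t0) (is_derive_id t 1).
  have dX := is_deriveX (f := fun u : R => u^-1) k dV.
  have dE := is_derive1_comp (f := expR) (g := fun u : R => - u^-1)
    (is_derive_expR _) (is_deriveN dV).
  apply: (is_derive_eq (near_eq_is_derive _ (is_deriveM dX dE))).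
    by near=> u; rewrite /flat ifT ?fctE//; near: u; exact: lt_nbhsr.
  rewrite !fctE /flat t0 /GRing.scale/=; case: (k) => [|j].
    by rewrite -exprVn /= !exprS; ring.
  rewrite -exprVn/= !exprS; ring.
- rewrite !flat_le0// mulr0 subr0.
  (* The difference quotient at 0 is [flat k.+1], since [flat k t = t * flat k.+1 t]; it remains to
     see that it tends to 0. *)
  apply/is_derive1_caratheodory; exists (flat k.+1); split; last by rewrite flat_le0.
    move=> z; rewrite (@flat_le0 k 0)// !subr0 /flat.
    by case: ifP => z0; rewrite ?mul0r// exprS [_ * z]mulrC -!mulrA mulVKf // gt_eqF.
  rewrite /prop_for /continuous_at flat_le0//; apply/(@cvgr0Pnorm_le R R^o) => e e0.
  have C0 : 0 < (k.+3)`!%:R :> R by rewrite ltr0n fact_gt0.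
  near=> u; apply: le_trans (flat_le_sqr _ _) _.
  have u1 : `|u| <= 1 by apply: ltW; near: u; exact: (@nbhs0_lt _ R^o).
  have ue : `|u| <= e / (k.+3)`!%:R.
    by apply: ltW; near: u; apply: (@nbhs0_lt _ R^o); rewrite divr_gt0.
  rewrite mulrC -ler_pdivlMr// expr2; apply: le_trans ue.
  by rewrite ler_piMr.
Unshelve. all: by end_near. Qed.

Lemma flat_differentiable k t : differentiable (flat k : R -> R) t.
Proof. by have [H _] := flat_is_derive k t; exact/derivable1_diffP. Qed.

(** Induction on the order [N] for all [k] at once: the derivative of [flat k] involves only
    [flat k.+1] and [flat k.+2]. *)
Lemma Ck_flat_comp n N (O : set 'rV[R]_n) (g : 'rV[R]_n -> R) k : open O ->
  Cinfty O g -> Ck N O (flat k \o g).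
Proof.
move=> oO Cg; have dg x : O x -> differentiable g x.
  by move=> Ox; have [H _] := Cg 1%N; exact: H.
elim: N k => [|N IH] k.
  move=> x Ox; apply: continuous_comp; first exact/differentiable_continuous/dg.
  exact/differentiable_continuous/flat_differentiable.
split=> [x Ox|i].
  by apply: differentiable_comp; [exact: dg|exact: flat_differentiable].
have Dg : Ck N O (fun x => 'D_(delta_mx 0 i) g x) by have [_ H] := Cg N.+1; exact: H.
have := CkM oO (CkD oO (IH k.+2) (CkM oO (Ck_cst N (- k%:R) oO) (IH k.+1))) Dg.
apply: Ck_ext => // x Ox /=; set v := delta_mx 0 i.
have df := flat_differentiable k (g x).
rewrite [RHS]deriveE; last exact: differentiable_comp (dg x Ox) df.
rewrite diff_comp//=; last exact: dg.
rewrite -(deriveE v (dg x Ox)) -[X in 'd _ _ X]mulr1.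
rewrite [X in 'd _ _ X](_ : _ = 'D_v g x *: (1 : R^o))//.
rewrite linearZ/= -(deriveE _ df).
have [_ ->] := flat_is_derive k (g x).
by rewrite mulNr mulrC.
Qed.

End Flat.

Section SmoothOnLocal.
Context {R : realType} {n : nat} {M : manifold R n}.

Lemma smooth_on_local (O : set M) (f : M -> R) :
  (forall p, O p -> exists2 U : set M, U p & smooth_on U f) -> smooth_on O f.
Proof.
move=> H c ac k; apply: Ck_local => y [cy Oy].
by have [U Uy sf] := H _ Oy; exists (chart_cod c `&` chart_inv c @^-1` U) => //; exact: sf.
Qed.

Lemma smooth_on_ext (O : set M) (f g : M -> R) : open O ->
  (forall p, O p -> f p = g p) -> smooth_on O f -> smooth_on O g.
Proof.
move=> oO fg sf c ac k; apply: Ck_ext (sf c ac k); first exact: open_chart_preimage.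
by move=> y [_ Oy] /=; exact: fg.
Qed.

Lemma smooth_on_subset (O U : set M) (f : M -> R) :
  U `<=` O -> smooth_on O f -> smooth_on U f.
Proof. by move=> UO sf; apply: smooth_on_local => p /UO Op; exists O. Qed.

(** In a chart, a smooth step function of the squared distance to [p], extended by zero. The closed
    set [C] serves to extend by zero products with functions known only over [U]. *)
Lemma bump_function (p : M) (U : set M) : nbhs p U ->
  exists (chi : C^oo(M)) (C : set M),
    [/\ closed C, C `<=` U, forall q, ~ C q -> chi q = 0
      & \forall q \near p, chi q = 1].
Proof.
move=> pU; have [c ac cp] := atlas_cover p.
set y0 := chart_map c p.
have : nbhs y0 (chart_cod c `&` chart_inv c @^-1` U).
  apply: (@filterI _ (nbhs y0)).
    by apply: open_nbhs_nbhs; split; [exact: chart_cod_open|exact: chart_mapP].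
  by apply: chart_inv_cts; [exact: chart_mapP|rewrite chart_mapK].
move=> /nbhs_ballP[e /= e0 ballU].
pose rho := e / 2; have rho0 : 0 < rho by rewrite divr_gt0.
pose K := [set y : 'rV[R]_n | forall i, `[y0 ord0 i - rho, y0 ord0 i + rho]%classic (y ord0 i)].
have KU : K `<=` chart_cod c `&` chart_inv c @^-1` U.
  move=> y Ky; apply: ballU; split=> // i j; rewrite ord1 /ball/=.
  have := Ky j; rewrite /= in_itv/= => /andP[H1 H2].
  by rewrite ltr_norml; apply/andP; split; move: rho0 H1 H2; rewrite /rho; lra.
pose C := chart_inv c @` K.
(* Compact in a Hausdorff space: [C] is closed in [M] itself, which makes the extension by zero
   smooth. *)
have cC : closed C.
  apply: compact_closed; first exact: manifold_hausdorff.
  apply: continuous_compact; last first.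
    apply: (@rV_compact _ _ (fun i => `[y0 ord0 i - rho, y0 ord0 i + rho]%classic)) => i.
    exact: segment_compact.
  apply: continuous_in_subspaceT => y /set_mem /KU[cy _]; exact: chart_inv_cts.
have CD q : C q -> chart_dom c q by move=> [y /KU[cy _] <-]; exact: chart_invP.
pose Q (y : 'rV[R]_n) := \sum_i (y 0 i - y0 0 i) * (y 0 i - y0 0 i).
(* Off [K], [Q y >= rho ^+ 2 = 2 * a] gives [a^-1 * Q y - 1 >= 1] and the step vanishes; where
   [Q y < a], it equals [kap]. *)
pose a := rho ^+ 2 / 2; have a0 : 0 < a by rewrite divr_gt0// exprn_gt0.
(* A smooth step without division: [flat 0 (flat 0 1 - flat 0 u)] is constant for
   u <= 0 and vanishes for u >= 1. *)
pose h (y : 'rV[R]_n) : R := flat 0 (flat 0 1 - flat 0 (a^-1 * Q y - 1)).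
pose kap := flat 0 (flat 0 1 : R).
have kap0 : 0 < kap by rewrite !flat_gt0.
have hK y : ~ K y -> h y = 0.
  move=> nK; rewrite /h flat_le0// subr_le0.
  have [i Hi] : exists i, rho < `|y 0 i - y0 0 i|.
    apply/not_existsP => H; apply: nK => i /=; rewrite in_itv/=.
    by have /negP := H i; rewrite -leNgt ler_norml; lra.
  have Qy : rho ^+ 2 <= Q y.
    rewrite /Q (bigD1 i)//=; apply: ler_wpDr.
      by apply: sumr_ge0 => j _; rewrite -expr2 sqr_ge0.
    rewrite -expr2 -(real_normK (num_real (y _ _ - _))).
    by rewrite lerXn2r ?nnegrE ?normr_ge0 ?(ltW rho0) ?(ltW Hi).
  have : 1 <= a^-1 * Q y - 1.
    by rewrite lerBrDr ler_pdivlMl//; apply: le_trans Qy; rewrite /a; lra.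
  move=> H; have u0 := lt_le_trans ltr01 H.
  by rewrite /flat ltr01 u0 !expr0 !mul1r ler_expR lerN2 lef_pV2 ?posrE.
pose chi q := if `[< chart_dom c q >] then kap^-1 * h (chart_map c q) else 0.
have chi0 q : ~ C q -> chi q = 0.
  move=> nC; rewrite /chi; case: asboolP => // cq.
  by rewrite hK ?mulr0// => Kq; apply: nC; exists (chart_map c q) => //; exact: chart_mapK.
have schi : smooth_on setT chi.
  apply: smooth_on_local => q _; have [Cq|nC] := pselect (C q); last first.
    exists (~` C) => //; apply: smooth_on_ext (smooth_on_cst _ 0).
      exact: closed_openC.
    by move=> ? /chi0 ->.
    exact: closed_openC.
  exists (chart_dom c); first exact: CD.
  move=> d ad; set W := _ `&` _.
  have oW : open W by apply: open_chart_preimage; exact: chart_dom_open.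
  have Ccoord i N : Ck N W (fun y => chart_map c (chart_inv d y) 0 i - y0 0 i).
    exact: CkD oW (atlas_compat ad ac i N) (Ck_cst N (- y0 0 i) oW).
  have CQ : Cinfty W (fun y => a^-1 * Q (chart_map c (chart_inv d y)) - 1).
    move=> N; apply: (CkD oW _ (Ck_cst N (-1) oW)).
    apply: (CkM oW (Ck_cst N a^-1 oW)).
    by apply: Ck_sum => // i; exact: CkM.
  have CQ2 : Cinfty W (fun y => flat 0 1 - flat 0 (a^-1 * Q (chart_map c (chart_inv d y)) - 1)).
    move=> N; have CN := CkM oW (Ck_cst N (-1) oW) (Ck_flat_comp N 0 oW CQ).
    apply: Ck_ext (CkD oW (Ck_cst N (flat 0 1) oW) CN) => //.
    by move=> y _ /=; rewrite mulN1r.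
  move=> N; apply: Ck_ext (CkM oW (Ck_cst N kap^-1 oW) (Ck_flat_comp N 0 oW CQ2)) => //.
  by move=> y [_ cy] /=; rewrite /chi asboolT.
exists (SmoothFun schi), C; split=> //; first by move=> q [y /KU[_ Uy] <-].
have cQ : {for y0, continuous Q}.
  have C0 i : Ck 0 setT (fun y : 'rV[R]_n => y 0 i - y0 0 i).
    by move=> y _; apply: continuousB; [exact: coord_continuous|exact: cst_continuous].
  have CQ : Ck 0 setT Q by apply: Ck_sum openT _ => i; exact: CkM openT (C0 i) (C0 i).
  exact: CQ.
have nQ : \forall q \near p, Q (chart_map c q) < a.
  have cQp : {for p, continuous (Q \o chart_map c)}.
    by apply: continuous_comp => //; exact: chart_map_cts.
  apply: (cvgr_lt (Q y0) cQp); rewrite /= -/y0.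
  by rewrite /Q big1 // => i _; rewrite subrr mul0r.
have nD : \forall q \near p, chart_dom c q.
  by apply: open_nbhs_nbhs; split=> //; exact: chart_dom_open.
near=> q; rewrite /= /chi asboolT; last by near: q.
rewrite /h [X in _ - X]flat_le0 ?subr0 ?mulVf ?gt_eqF//.
rewrite subr_le0 mulrC ler_pdivrMr// mul1r ltW//.
by near: q.
Unshelve. all: by end_near. Qed.

End SmoothOnLocal.

(** * Locality of tangent vectors, and covectors as differentials of functions *)

Section Tangent.
Context {R : realType} {n : nat} {M : manifold R n}.

Lemma tangentf0 (p : M) (v : tangent p) : v 0 = 0.
Proof.
by have := tangent_linear v (-1) 0 0; rewrite scaleN1r addNr mulN1r addNr.
Qed.

Lemma tangentfD (p : M) (v : tangent p) f g : v (f + g) = v f + v g.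
Proof. by rewrite -[f]scale1r tangent_linear mul1r scale1r. Qed.

Lemma tangentfZ (p : M) (v : tangent p) a f : v (a *: f) = a * v f.
Proof. by rewrite -[a *: f]addr0 tangent_linear tangentf0 addr0. Qed.

Lemma tangentfB (p : M) (v : tangent p) f g : v (f - g) = v f - v g.
Proof. by rewrite tangentfD -scaleN1r tangentfZ mulN1r. Qed.

Lemma tangentf_sum (p : M) (v : tangent p) I (s : seq I) (f : I -> C^oo(M)) :
  v (\sum_(i <- s) f i) = \sum_(i <- s) v (f i).
Proof. exact: (big_morph _ (tangentfD v) (tangentf0 v)). Qed.

(** Leibniz at [p] for [chi * (f - g) = 0], with a bump function [chi] supported where [f] and [g]
    agree: only [v (f - g)] survives. *)
Lemma tangent_local (p : M) (v : tangent p) (f g : C^oo(M)) :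
  (\forall q \near p, f q = g q) -> v f = v g.
Proof.
move=> fg; apply/eqP; rewrite -subr_eq0 -tangentfB.
have [chi [C [_ CU chi0 /nbhs_singleton chi1]]] := bump_function fg.
have E : chi * (f - g) = 0.
  apply: smoothfun_eq => q; rewrite !smoothfunE.
  have [/CU -> |/chi0 ->] := pselect (C q); last by rewrite mul0r.
  by rewrite subrr mulr0.
have := tangent_leibniz v chi (f - g).
rewrite E tangentf0 chi1 !smoothfunE (nbhs_singleton fg) subrr mulr0 add0r mul1r.
by move=> <-.
Qed.

(* A covector is the evaluation at a function, as far as finitely many tangent
   vectors can see: the vectors (v_i(f))_i fill the annihilator of the linear
   relations between the v_i. *)
Lemma covector_eval (p : M) (I : finType) (v : I -> tangent p)
    (xi : {linear tangent p -> R^o}) :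
  exists f : C^oo(M), forall i, xi (v i) = v i f.
Proof.
pose k := #|I|; pose w (j : 'I_k) : tangent p := v (enum_val j).
suff [f Hf] : exists f : C^oo(M), forall j, xi (w j) = w j f.
  by exists f => i; have := Hf (enum_rank i); rewrite /w enum_rankK.
pose ev f : 'rV[R]_k := \row_j w j f.
pose mat d (f : 'I_d -> C^oo(M)) : 'M[R]_(d, k) := \matrix_i ev (f i).
pose P s := `[< exists d (f : 'I_d -> C^oo(M)), \rank (mat d f) = s >].
have P0 : exists s, P s.
  by exists (\rank (mat 0%N (fun=> 0))); apply/asboolP; exists 0%N, (fun=> 0).
have Pk s : P s -> (s <= k)%N by move=> /asboolP[d [f <-]]; exact: rank_leq_col.
(* Ranks are at most [k], so some family [f] has maximal rank; its rows span every [ev g], as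
   adjoining [g] cannot raise the rank. *)
have [s /asboolP[d [f fs]] smax] := ex_maxnP P0 Pk.
have sub g : (ev g <= mat d f)%MS.
  have : (\rank (mat d f + ev g)%MS <= \rank (mat d f))%N.
    rewrite fs; apply: smax; apply/asboolP.
    exists (d + 1)%N, (fun i : 'I_(d + 1) =>
      match fintype.split i with inl j => f j | inr _ => g end).
    rewrite addsmxE; congr (\rank _); apply/row_matrixP => i.
    rewrite rowK; case: (split_ordP i) => j ->; rewrite ?rowKu ?rowKd.
      by rewrite rowK.
    by rewrite ord1 row_id.
  move=> le; have /eqmxP : (mat d f == mat d f + ev g)%MS.
    by rewrite -(geq_leqif (mxrank_leqif_eq (addsmxSl _ _))).
  by move=> ->; exact: addsmxSr.
pose u : 'rV[R]_k := \row_j xi (w j).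
have : (u <= mat d f)%MS.
  rewrite submxE; apply/eqP/rowP => c; rewrite [RHS]mxE.
  (* A column of the cokernel is a linear relation between the [w j], since it kills every [ev g];
     [xi] preserves this relation. *)
  have : \sum_j (cokermx (mat d f)) j c *: w j = 0.
    apply: tangent_eq => g.
    have /submxP[z Hz] := sub g.
    have : ev g *m cokermx (mat d f) = 0 by rewrite Hz -mulmxA mulmx_coker mulmx0.
    move=> /rowP/(_ c); rewrite !mxE => H0; rewrite tangent0E -[RHS]H0.
    elim/big_rec2: _ => // j a b _ IH.
    by rewrite tangentDE tangentZE IH [ev g _ _]mxE mulrC.
  move=> /(congr1 xi); rewrite linear0 linear_sum/= => <-.
  by rewrite mxE; apply: eq_bigr => j _; rewrite [u _ _]mxE linearZ/= mulrC.
move=> /submxP[z Hz]; exists (\sum_i z 0 i *: f i) => j.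
have /rowP/(_ j) := Hz; rewrite !mxE => ->.
by rewrite tangentf_sum; apply: eq_bigr => i _; rewrite !mxE tangentfZ.
Qed.

End Tangent.

(** * Local frames and tensoriality *)

Section SectTheory.
Context {R : realType} {n : nat} {M : manifold R n}.

(** Extension by zero: near [C] both factors are smooth, and off the closed set [C] the product is
    0. *)
Lemma smooth_cutoff (chi : C^oo(M)) (C O U : set M) (g : M -> R) :
  closed C -> C `<=` U -> (forall q, ~ C q -> chi q = 0) -> open O -> open U ->
  smooth_on (O `&` U) g -> smooth_on O (fun q => chi q * g q).
Proof.
move=> cC CU chi0 oO oU sg; apply: smooth_on_local => p Op.
have [Cp|nC] := pselect (C p).
  exists (O `&` U); first by split=> //; exact: CU.
  have oOU := openI oO oU.
  have H := smooth_onM oOU (smooth_on_sub _ (smoothfunP chi)) sg.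
  exact: H.
have oC := closed_openC cC.
exists (~` C) => //; apply: smooth_on_ext (smooth_on_cst oC 0) => //.
by move=> q /chi0 ->; rewrite mul0r.
Qed.

Lemma smoothfun_sumE (I : Type) (s : seq I) (F : I -> C^oo(M)) m :
  (\sum_(i <- s) F i) m = \sum_(i <- s) F i m.
Proof. exact: (big_morph (fun f : C^oo(M) => f m) (fun _ _ => erefl) erefl). Qed.

Lemma sect_sumE (E : vfam M) (I : Type) (s : seq I) (F : I -> sect E) m :
  (\sum_(i <- s) F i) m = \sum_(i <- s) F i m.
Proof. exact: (big_morph (fun x : sect E => x m) (fun _ _ => erefl) erefl). Qed.

Lemma lform_sumE (V : lmodType R) (I : Type) (s : seq I)
    (F : I -> {linear V -> R^o}) v :
  (\sum_(i <- s) F i) v = \sum_(i <- s) F i v.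
Proof. exact: (big_morph (fun f : {linear V -> R^o} => f v) (fun _ _ => erefl) erefl). Qed.

Lemma lformZr (V : lmodType R) (f : {linear V -> R^o}) a v : f (a *: v) = a * f v.
Proof. exact: linearZ. Qed.

End SectTheory.

Section Frames.
Context {R : realType} {n : nat} {M : manifold R n} {r : nat}.
Variable A : vbundle M r.

Section TrivCoord.
Variables (t : local_triv r (vfib A)) (m : M) (i : 'I_r).
Definition triv_coord (v : vfib A m) : R^o := triv_map t m v 0 i.
Let triv_coord_linear : linear triv_coord.
Proof. by move=> a v w; rewrite /triv_coord linearP !mxE. Qed.
HB.instance Definition _ :=
  GRing.isLinear.Build R (vfib A m) R^o _ triv_coord triv_coord_linear.
End TrivCoord.

Lemma smooth_frame_sec (chi : C^oo(M)) (C : set M) (t : local_triv r (vfib A))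
    (i : 'I_r) :
  vatlas t -> closed C -> C `<=` triv_dom t -> (forall q, ~ C q -> chi q = 0) ->
  vbundle_smooth (fun q => chi q *: triv_inv t q (delta_mx 0 i)).
Proof.
move=> at_ cC Ct chi0 u au j.
have := smooth_cutoff cC Ct chi0 (triv_dom_open u) (triv_dom_open t)
  (g := fun q => triv_map u q (triv_inv t q (delta_mx 0 i)) 0 j).
have sg := vatlas_compat at_ au (delta_mx 0 i) j.
rewrite setIC => /(_ sg); congr smooth_on; apply/funext => q.
by rewrite linearZ mxE.
Qed.

Lemma smooth_coframe_sec (chi : C^oo(M)) (C : set M) (t : local_triv r (vfib A))
    (i : 'I_r) :
  vatlas t -> closed C -> C `<=` triv_dom t -> (forall q, ~ C q -> chi q = 0) ->
  dual_smooth (E := A) (fun q => chi q *: (triv_coord t (m := q) i : {linear _ -> _})).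
Proof.
move=> at_ cC Ct chi0 x.
apply: (smooth_cutoff cC Ct chi0 openT (triv_dom_open t)).
by rewrite setTI; exact: (sectP x).
Qed.

(* A frame over a neighbourhood of m, cut off: the partial identity
   [chi = sum_i e_i (x) eps_i] holds over the whole of M. *)
Lemma vbundle_frame (m : M) :
  exists (chi : C^oo(M)) (e : 'I_r -> sect A) (eps : 'I_r -> sect (dual A)),
  [/\ \forall q \near m, chi q = 1,
      forall q (v : A q), chi q *: v = \sum_i (eps i q v : R) *: e i q
    & forall q, \sum_i (eps i q (e i q) : R) = r%:R * chi q].
Proof.
have [t at_ tm] := vatlas_cover A m.
have nt : nbhs m (triv_dom t).
  by apply: open_nbhs_nbhs; split=> //; exact: triv_dom_open.
have [chi [C [cC Ct chi0 chi1]]] := bump_function nt.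
exists (chi * chi), (fun i => Sect (E := A) (smooth_frame_sec i at_ cC Ct chi0)),
  (fun i => Sect (E := dual A) (smooth_coframe_sec i at_ cC Ct chi0)); split=> [|q v|q].
- by near=> q; rewrite smoothfunE (_ : chi q = 1) ?mulr1//; near: q.
- rewrite smoothfunE /=.
  have [/Ct tq|/chi0 ->] := pselect (C q); last first.
    by rewrite mul0r scale0r big1// => i _; rewrite !scale0r.
  apply: (can_inj (triv_mapK tq)); rewrite linearZ linear_sum/=.
  rewrite [triv_map _ _ v]row_sum_delta scaler_sumr; apply: eq_bigr => i _.
  by rewrite !linearZ/= triv_invK// !scalerA -[_ *: triv_coord t i v]/(_ * _) mulrC mulrAC.
- rewrite smoothfunE /=.
  have [/Ct tq|/chi0 ->] := pselect (C q); last first.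
    by rewrite mul0r mulr0 big1// => i _; rewrite !scale0r.
  rewrite (eq_bigr (fun=> chi q * chi q)).
    by rewrite sumr_const card_ord mulr_natl.
  move=> i _; rewrite /triv_coord linearZ mxE triv_invK// mxE !eqxx mulr1.
  by [].
Unshelve. all: by end_near. Qed.

Lemma vbundle_smooth_local (x : forall m, A m) :
  (forall m : M, exists y : sect A, \forall q \near m, x q = y q) ->
  vbundle_smooth x.
Proof.
move=> H t at_ i; apply: smooth_on_local => p tp.
have [y] := H p; rewrite /prop_near1 nbhsE => -[U [oU Up] Uxy].
exists (triv_dom t `&` U); first by [].
have oO := openI (triv_dom_open t) oU.
apply: smooth_on_ext (smooth_on_subset (@subIsetl _ _ _) (sectP y t at_ i)) => //.
by move=> q [_ /Uxy ->].
Qed.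

(** Near a point, [bidual (L q)] has the smooth coefficients [L q (eps i q)] in a local frame. *)
Lemma bidual_smooth (L : forall m, {linear {linear vfib A m -> R^o} -> R^o}) :
  (forall xi : sect (dual A), smooth_on setT (fun m => L m (xi m))) ->
  vbundle_smooth (fun m => bidual (L m)).
Proof.
move=> sL; apply: vbundle_smooth_local => m.
have [chi [e [eps [chi1 He _]]]] := vbundle_frame m.
exists (\sum_i SmoothFun (sL (eps i)) *s e i); near=> q.
have chiq : chi q = 1 by near: q.
rewrite sect_sumE -[LHS]scale1r -chiq (He q (bidual (L q))).
by apply: eq_bigr => i _ /=; rewrite bidualE.
Unshelve. all: by end_near. Qed.

Lemma dual_separates (m : M) (v w : A m) :
  (forall xi : sect (dual A), xi m v = xi m w) -> v = w.
Proof.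
move=> vw; have [chi [e [eps [/nbhs_singleton chi1 He _]]]] := vbundle_frame m.
rewrite -[v]scale1r -[w]scale1r -chi1 !He.
by apply: eq_bigr => i _; rewrite vw.
Qed.

Lemma pairZl f (xi : sect (dual A)) x : pair (f *s xi) x = f * pair xi x.
Proof. exact: smoothfun_eq. Qed.
Lemma pairZr f (xi : sect (dual A)) x : pair xi (f *s x) = f * pair xi x.
Proof. by apply: smoothfun_eq => m /=; rewrite linearZ. Qed.
Lemma pairDl (xi eta : sect (dual A)) x : pair (xi + eta) x = pair xi x + pair eta x.
Proof. exact: smoothfun_eq. Qed.
Lemma pairDr (xi : sect (dual A)) x y : pair xi (x + y) = pair xi x + pair xi y.
Proof. by apply: smoothfun_eq => m /=; rewrite linearD. Qed.
Lemma pairBl (xi eta : sect (dual A)) x : pair (xi - eta) x = pair xi x - pair eta x.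
Proof. exact: smoothfun_eq. Qed.
Lemma pairBr (xi : sect (dual A)) x y : pair xi (x - y) = pair xi x - pair xi y.
Proof. by apply: smoothfun_eq => m /=; rewrite linearB. Qed.

Lemma sect_addr_sum (E : vfam M) (K : sect E -> C^oo(M)) :
  (forall x y, K (x + y) = K x + K y) ->
  forall (I : Type) (s : seq I) (F : I -> sect E),
    K (\sum_(i <- s) F i) = \sum_(i <- s) K (F i).
Proof.
move=> KD I s F; apply: (big_morph K KD).
by apply: (addrI (K 0)); rewrite -KD !addr0.
Qed.

(** [K x m] depends only on [x m]: replace [x] by [chi *s x], expand it in a frame and pull the
    coefficients out of [K]. *)
Lemma tensorial_dual (K : sect A -> C^oo(M)) :
  (forall x y, K (x + y) = K x + K y) ->
  (forall f x, K (f *s x) = f * K x) ->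
  exists xi : sect (dual A), forall x, pair xi x = K x.
Proof.
move=> KD KZ.
(* One frame is chosen per point, without compatibility between them: smoothness of [theta] comes
   from that of the functions [K x]. *)
have /choice[D HD] (m : M) :
    exists D : C^oo(M) * ('I_r -> sect A) * ('I_r -> sect (dual A)),
    D.1.1 m = 1 /\ forall q (v : A q),
      D.1.1 q *: v = \sum_i (D.2 i q v : R) *: D.1.2 i q.
  have [chi [e [eps [/nbhs_singleton chi1 He _]]]] := vbundle_frame m.
  by exists (chi, e, eps).
pose theta m : dual A m := \sum_i K ((D m).1.2 i) m *: (D m).2 i m.
have thetaE (m : M) (x : sect A) : (theta m : {linear A m -> R^o}) (x m) = K x m.
  rewrite /theta; case: (D m) (HD m) => -[chi e] eps /= [chi1 He].
  have <- : K (chi *s x) m = K x m by rewrite KZ smoothfunME chi1 mul1r.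
  have -> : chi *s x = \sum_i pair (eps i) x *s e i.
    by apply: sect_eq => q; rewrite sect_sumE; exact: He.
  rewrite (sect_addr_sum KD) smoothfun_sumE lform_sumE.
  by apply: eq_bigr => i _; rewrite KZ smoothfunE lformZE mulrC.
have stheta : dual_smooth (E := A) theta.
  by move=> x; have := smoothfunP (K x); congr smooth_on; apply/funext => m.
by exists (Sect (E := dual A) stheta) => x; apply: smoothfun_eq => m; exact: thetaE.
Qed.

End Frames.

(** * Hom-Lie algebroids and the Hom-Schouten bracket *)

Section PullbackAct.
Context {R : realType} {n : nat} {M : manifold R n}.

Lemma pullbackE (psi : smoothmap M M) f m : pullback psi f m = f (psi m).
Proof. by []. Qed.
Lemma pullbackD (psi : smoothmap M M) f g :
  pullback psi (f + g) = pullback psi f + pullback psi g.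
Proof. exact: smoothfun_eq. Qed.
Lemma pullbackB (psi : smoothmap M M) f g :
  pullback psi (f - g) = pullback psi f - pullback psi g.
Proof. exact: smoothfun_eq. Qed.
Lemma pullbackN (psi : smoothmap M M) f : pullback psi (- f) = - pullback psi f.
Proof. exact: smoothfun_eq. Qed.
Lemma pullbackZ (psi : smoothmap M M) (k : R) f : pullback psi (k *: f) = k *: pullback psi f.
Proof. exact: smoothfun_eq. Qed.
Lemma pullbackM (psi : smoothmap M M) f g :
  pullback psi (f * g) = pullback psi f * pullback psi g.
Proof. exact: smoothfun_eq. Qed.
Lemma pullback0 (psi : smoothmap M M) : pullback psi 0 = 0 :> C^oo(M).
Proof. exact: smoothfun_eq. Qed.

Lemma pullback_sum (psi : smoothmap M M) (I : Type) (s : seq I) (k : I -> C^oo(M)) :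
  pullback psi (\sum_(i <- s) k i) = \sum_(i <- s) pullback psi (k i).
Proof. exact: (big_morph _ (pullbackD psi) (pullback0 psi)). Qed.

Lemma pullback_invK (phi : diffeo M) f :
  pullback phi (pullback (diffeo_inv phi) f) = f.
Proof. by apply: smoothfun_eq => m /=; rewrite diffeoK. Qed.
Lemma pullbackK (phi : diffeo M) f :
  pullback (diffeo_inv phi) (pullback phi f) = f.
Proof. by apply: smoothfun_eq => m /=; rewrite diffeo_invK. Qed.

Lemma pullback_inj (phi : diffeo M) : injective (pullback phi).
Proof. exact: can_inj (pullbackK phi). Qed.

Lemma actf0 (psi : smoothmap M M) (x : sect (ptan psi)) : act x 0 = 0.
Proof. by apply: smoothfun_eq => m; rewrite actE tangentf0. Qed.
Lemma actfD (psi : smoothmap M M) (x : sect (ptan psi)) f g :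
  act x (f + g) = act x f + act x g.
Proof. by apply: smoothfun_eq => m; rewrite smoothfunE !actE tangentfD. Qed.
Lemma actfB (psi : smoothmap M M) (x : sect (ptan psi)) f g :
  act x (f - g) = act x f - act x g.
Proof. by apply: smoothfun_eq => m; rewrite !smoothfunE !actE tangentfB. Qed.
Lemma actfN (psi : smoothmap M M) (x : sect (ptan psi)) f :
  act x (- f) = - act x f.
Proof. by rewrite -sub0r actfB actf0 sub0r. Qed.

End PullbackAct.

Section Algebroid.
Context {R : realType} {n : nat} {M : manifold R n}.
Context {E : vfam M} {phi : diffeo M} {phiE : inv_hom_bundle E phi}.
Local Notation F := (pullback phi).
Local Notation G := (pullback (diffeo_inv phi)).

Lemma hbD (x y : sect E) : phiE (x + y) = phiE x + phiE y.
Proof. by have := hb_linear phiE 1 x y; rewrite !scale1r. Qed.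
Lemma hbB (x y : sect E) : phiE (x - y) = phiE x - phiE y.
Proof. by have := hb_linear phiE (-1) y x; rewrite !scaleN1r ![- _ + _]addrC. Qed.

Lemma ihb_invD (x y : sect E) :
  ihb_inv phiE (x + y) = ihb_inv phiE x + ihb_inv phiE y.
Proof.
by apply: (can_inj (ihbK phiE)); rewrite hbD !ihb_invK.
Qed.

Lemma ihb_invB (x y : sect E) :
  ihb_inv phiE (x - y) = ihb_inv phiE x - ihb_inv phiE y.
Proof. by apply: (can_inj (ihbK phiE)); rewrite hbB !ihb_invK. Qed.

Lemma ihb_invZ f (x : sect E) : ihb_inv phiE (f *s x) = G f *s ihb_inv phiE x.
Proof.
by apply: (can_inj (ihbK phiE)); rewrite hb_semilinear !ihb_invK pullback_invK.
Qed.

Variable L : hom_lie_algebroid phiE.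
Local Notation br := (bracket L).
Local Notation a x := (act (bmap_sect (anchor L) x)).
Let HL := bracket_hom_lie L.
Let HR := anchor_representation L.

Lemma brDr x y z : br x (y + z) = br x y + br x z.
Proof. by have := hla_bilinearr HL x 1 y z; rewrite !scale1r. Qed.
Lemma brBr x y z : br x (y - z) = br x y - br x z.
Proof. by have := hla_bilinearr HL x (-1) z y; rewrite !scaleN1r ![- _ + _]addrC. Qed.
Lemma brDl x y z : br (x + y) z = br x z + br y z.
Proof. by have := hla_bilinearl HL z 1 x y; rewrite !scale1r. Qed.

Lemma br_leibl f x y : br (f *s x) y = F f *s br x y - a (phiE y) f *s phiE x.
Proof.
rewrite (hla_skew HL) bracket_leibniz (hla_skew HL y x) opprD; congr (_ - _).
by apply: sect_eq => m /=; rewrite scalerN opprK.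
Qed.

Lemma anchorD x y f : a (x + y) f = a x f + a y f.
Proof. by apply: smoothfun_eq => m; rewrite smoothfunE !actE /= linearD. Qed.
Lemma anchorZ g x f : a (g *s x) f = g * a x f.
Proof. by apply: smoothfun_eq => m; rewrite smoothfunE !actE /= linearZ. Qed.

Lemma anchor_hb x f : a (phiE x) (F f) = F (a x f).
Proof. exact: (hlr_beta HR). Qed.
Lemma anchor_bracket x y f : a (br x y) (F f) = a (phiE x) (a y f) - a (phiE y) (a x f).
Proof. exact: (hlr_bracket HR). Qed.

(** Leibniz for [chi *s (y - z) = 0], as in [tangent_local]; the twist by [phi] places the
    neighbourhood at [phi m]. *)
Lemma bracket_local (x y z : sect E) (m : M) : (\forall q \near phi m, y q = z q) ->
  br x y m = br x z m.
Proof.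
move=> yz; have [chi [C [_ CU chi0 /nbhs_singleton chi1]]] := bump_function yz.
have E0 : chi *s (y - z) = 0.
  apply: sect_eq => q /=.
  have [/CU -> |/chi0 ->] := pselect (C q); last by rewrite scale0r.
  by rewrite subrr scaler0.
have P0 : phiE (y - z) m = 0.
  have := hb_semilinear phiE chi (y - z); rewrite E0 => /(congr1 (fun x => sect_val x m)).
  rewrite /= chi1 scale1r => <-.
  by rewrite -[X in phiE X](subrr 0) hbB subrr.
have := bracket_leibniz L x chi (y - z).
have -> : br x (chi *s (y - z)) = 0 by rewrite E0 -[X in br _ X](subrr 0) brBr subrr.
move=> /(congr1 (fun x => sect_val x m)) /=.
rewrite chi1 scale1r P0 scaler0 addr0 brBr => /esym/eqP.
by rewrite subr_eq0 => /eqP.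
Qed.

End Algebroid.

Section PairArg.
Context {T : Type}.

Definition pair_arg (a b : T) : 'I_2 -> T := fun l => if l == ord0 then a else b.

End PairArg.

Section Wedge.
Context {R : realType} {n : nat} {M : manifold R n} {E : vfam M}.

Lemma enum_I1 : enum 'I_1 = [:: ord0].
Proof. by rewrite enum_ordSl enum_ord0. Qed.
Lemma lift01 : lift ord0 ord0 = ord_max :> 'I_2. Proof. exact/val_inj. Qed.
Lemma enum_I2 : enum 'I_2 = [:: ord0; ord_max].
Proof. by rewrite enum_ordSl enum_I1 /= lift01. Qed.

Lemma wedge1E (x : 'I_1 -> sect E) (xi : 'I_1 -> sect (dual E)) (m : M) :
  wedge x xi m = xi ord0 m (x ord0 m).
Proof. by rewrite /wedge det_mx11 mxE. Qed.

(** Entries are indexed by [nat] so that the shifted indices of the minors compute. *)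
Lemma det_mx2 (a : nat -> nat -> R) :
  \det (\matrix_(i < 2, j < 2) a i j)
  = a 0%N 0%N * a 1%N 1%N - a 0%N 1%N * a 1%N 0%N.
Proof.
rewrite (expand_det_row _ ord0) !big_ord_recl big_ord0 addr0.
by rewrite /cofactor !det_mx11 !mxE /= /bump /= expr0 expr1 mul1r mulN1r mulrN.
Qed.

Lemma det_mx3 (a : nat -> nat -> R) :
  \det (\matrix_(i < 3, j < 3) a i j)
  = a 0%N 0%N * (a 1%N 1%N * a 2%N 2%N - a 1%N 2%N * a 2%N 1%N)
    - a 0%N 1%N * (a 1%N 0%N * a 2%N 2%N - a 1%N 2%N * a 2%N 0%N)
    + a 0%N 2%N * (a 1%N 0%N * a 2%N 1%N - a 1%N 1%N * a 2%N 0%N).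
Proof.
rewrite (expand_det_row _ ord0) !big_ord_recl big_ord0 addr0.
rewrite /cofactor !(expand_det_row _ ord0) !big_ord_recl !big_ord0 !addr0.
rewrite /cofactor !det_mx11 !mxE /= /bump /=; ring.
Qed.

Lemma wedge_inord k (x : 'I_k.+1 -> sect E) (xi : 'I_k.+1 -> sect (dual E)) (m : M) :
  wedge x xi m
  = \det (\matrix_(i < k.+1, j < k.+1) (xi (inord i) m (x (inord j) m) : R)).
Proof. by congr (\det _); apply/matrixP => i j; rewrite !mxE !inord_val. Qed.

Lemma inord0 k : inord 0 = ord0 :> 'I_k.+1.
Proof. by apply/val_inj; rewrite /= inordK. Qed.
Lemma inord_max k : inord k = ord_max :> 'I_k.+1.
Proof. by apply/val_inj; rewrite /= inordK. Qed.

Lemma wedge2E (x : 'I_2 -> sect E) (xi : 'I_2 -> sect (dual E)) (m : M) :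
  wedge x xi m = (xi ord0 m (x ord0 m) : R) * xi ord_max m (x ord_max m)
    - (xi ord0 m (x ord_max m) : R) * xi ord_max m (x ord0 m).
Proof.
rewrite wedge_inord (det_mx2 (fun i j => xi (inord i) m (x (inord j) m))).
by rewrite !inord0 !inord_max.
Qed.

Lemma wedge3E (x : 'I_3 -> sect E) (xi : 'I_3 -> sect (dual E)) (m : M) :
  let e i j : R := xi (inord i) m (x (inord j) m) in
  wedge x xi m
  = e 0%N 0%N * (e 1%N 1%N * e 2%N 2%N - e 1%N 2%N * e 2%N 1%N)
    - e 0%N 1%N * (e 1%N 0%N * e 2%N 2%N - e 1%N 2%N * e 2%N 0%N)
    + e 0%N 2%N * (e 1%N 0%N * e 2%N 1%N - e 1%N 1%N * e 2%N 0%N).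
Proof.
by move=> e; rewrite wedge_inord (det_mx3 (fun i j => xi (inord i) m (x (inord j) m))).
Qed.

End Wedge.

(** * Hom-Lie derivatives and the Schouten bracket of a bivector with a section *)

Section HomLieDerivative.
Context {R : realType} {n : nat} {M : manifold R n} {r : nat}.
Context {A : vbundle M r} {phi : diffeo M}.
Context {phiA : inv_hom_bundle A phi} {phiAd : inv_hom_bundle (dual A) phi}.
Variables (LA : hom_lie_algebroid phiA) (LAd : hom_lie_algebroid phiAd).
Local Notation F := (pullback phi).
Local Notation G := (pullback (diffeo_inv phi)).
Local Notation iA := (ihb_inv phiA).
Local Notation iD := (ihb_inv phiAd).
Local Notation brA := (bracket LA).
Local Notation brD := (bracket LAd).
Local Notation a x := (act (bmap_sect (anchor LA) x)).
Local Notation b xi := (act (bmap_sect (anchor LAd) xi)).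

(* d_* x, evaluated on two sections of A^*; locked, since ring-like rewriting would
   otherwise see through it to the defining sums *)
Definition dstar (x : sect A) (xi eta : sect (dual A)) : C^oo(M) :=
  locked (differential LAd (sect_kform x) (pair_arg xi eta)).

Lemma dstarE x xi eta : dstar x xi eta = b xi (pair (iD eta) x)
  - b eta (pair (iD xi) x) - F (pair (iD (brD (iD xi) (iD eta))) x).
Proof.
rewrite /dstar -lock /differential !big_ord_recl !big_ord0 !addr0.
rewrite !big_mkcond !big_ord_recl !big_ord0 /= !addr0 !add0r.
rewrite /sect_kform /dagger /= lift01 /=.
have -> : lift ord_max (ord0 : 'I_1) = ord0 :> 'I_2 by exact/val_inj.
rewrite big_pred0 => [|j]; last by rewrite ltnNge -ltnS ltn_ord.
by rewrite /pair_arg /= /bump /= expr0 expr1 mul1r !mulN1r addr0.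
Qed.

Lemma schouten21E (x : 'I_2 -> sect A) (y : 'I_1 -> sect A)
    (xi : 'I_2 -> sect (dual A)) m :
  schouten_decomposable LA (p := 1) (q := 0) x y xi m
  = (xi ord0 m (brA (x ord0) (y ord0) m) : R) * xi ord_max m (phiA (x ord_max) m)
    - (xi ord_max m (brA (x ord0) (y ord0) m) : R) * xi ord0 m (phiA (x ord_max) m)
    - (xi ord0 m (brA (x ord_max) (y ord0) m) : R) * xi ord_max m (phiA (x ord0) m)
    + (xi ord_max m (brA (x ord_max) (y ord0) m) : R) * xi ord0 m (phiA (x ord0) m).
Proof.
rewrite /schouten_decomposable !big_ord_recl !big_ord0.
rewrite !enum_I1 !enum_I2 !lift01 /= !wedge2E /=; ring.
Qed.

Lemma schouten12E (x : 'I_1 -> sect A) (y : 'I_2 -> sect A)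
    (xi : 'I_2 -> sect (dual A)) m :
  schouten_decomposable LA (p := 0) (q := 1) x y xi m
  = - schouten_decomposable LA (p := 1) (q := 0) y x xi m.
Proof.
have skew z : brA (x ord0) (y z) m = - brA (y z) (x ord0) m.
  by rewrite (hla_skew (bracket_hom_lie LA)).
rewrite schouten21E /schouten_decomposable !big_ord_recl !big_ord0.
rewrite !enum_I1 !enum_I2 !lift01 /= !wedge2E /= !skew !linearN /=; ring.
Qed.

Hypothesis hdag : forall (xi : sect (dual A)) (x : sect A),
  pair (phiAd xi) x = F (pair xi (iA x)).

Lemma pair_iD xi x : F (pair (iD xi) x) = pair xi (phiA x).
Proof. by rewrite -{2}[xi](ihb_invK phiAd) hdag ihbK. Qed.

(* theta is, up to the twists, the Lie derivative of xi along y. *)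
Definition is_lie (y : sect A) (xi theta : sect (dual A)) := forall x,
  F (pair theta x) = pair xi (brA x y) + a (phiA y) (pair (iD xi) x).

(** The two terms fail to be linear over functions in [x] by opposite amounts, so [tensorial_dual]
    applies to their sum, untwisted by [G]. *)
Lemma is_lie_exists y xi : exists theta, is_lie y xi theta.
Proof.
pose K x := G (pair xi (brA x y) + a (phiA y) (pair (iD xi) x)).
have KD x x' : K (x + x') = K x + K x'.
  by rewrite /K brDl !pairDr actfD -pullbackD addrACA.
have KZ f x : K (f *s x) = f * K x.
  rewrite /K br_leibl pairBr !pairZr act_leibniz pair_iD.
  rewrite -[f in RHS](pullbackK phi) -pullbackM; congr (G _).
  by apply: smoothfun_eq => m; rewrite !smoothfunE; ring.
have [theta Htheta] := tensorial_dual KD KZ.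
by exists theta => x; rewrite Htheta /K pullback_invK.
Qed.

(* The right-hand side does not depend on the decompositions in [is_schouten]. *)
Lemma schouten21_formula (P : kform (dual A) 2) (y : sect A) (S : kform (dual A) 2) :
  is_schouten LA (p := 1) (q := 0) P (sect_kform y) S ->
  forall xi eta txi teta, is_lie y xi txi -> is_lie y eta teta ->
  S (pair_arg xi eta) = F (P (pair_arg txi (iD eta)))
    + F (P (pair_arg (iD xi) teta)) - a (phiA y) (P (pair_arg (iD xi) (iD eta))).
Proof.
move=> HS xi eta txi teta Lxi Leta; apply: smoothfun_eq => m.
have [s [t [Ps yt ->]]] := HS m.
(* The decomposition of [y] is summed away: near [phi m], [y] is the sum of the entries of [t], and
   the bracket is local. *)
have brt (z : sect (dual A)) x :
    \sum_(w <- t) (z m (brA x (w ord0) m) : R) = z m (brA x y m).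
  have -> : brA x y m = brA x (\sum_(w <- t) w ord0) m.
    apply: bracket_local; apply: filterS yt => q Hq.
    apply: dual_separates => ze; rewrite sect_sumE linear_sum /=.
    have := Hq (fun=> ze); rewrite /sect_kform /= => ->.
    by apply: eq_bigr => w _; rewrite wedge1E.
  rewrite (big_morph (brA x) (brDr LA x) (id1 := 0)) ?sect_sumE ?linear_sum//.
  by rewrite -[X in brA _ X](subrr 0) brBr subrr.
pose v : tangent (phi m) := bmap_sect (anchor LA) (phiA y) m.
have lie z tz (x : sect A) : is_lie y z tz ->
    (tz (phi m) (x (phi m)) : R) = z m (brA x y m) + v (pair (iD z) x).
  by move=> /(_ x) /(congr1 (fun f : C^oo(M) => f m)).
have iDE z (x : sect A) : (iD z (phi m) (x (phi m)) : R) = z m (phiA x m).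
  by have /(congr1 (fun f : C^oo(M) => f m)) := pair_iD z x.
rewrite !smoothfunE actE -/v.
(* A tangent vector at [phi m] sees only germs, so the decomposition of [P] may be inserted under
   [v]; the rest is checked on each decomposable. *)
have -> : v (P (pair_arg (iD xi) (iD eta))) = v (\sum_(x <- s)
    (pair (iD xi) (x ord0) * pair (iD eta) (x ord_max)
     - pair (iD xi) (x ord_max) * pair (iD eta) (x ord0))).
  apply: tangent_local; apply: filterS Ps => q ->.
  by rewrite smoothfun_sumE; apply: eq_bigr => x _; rewrite wedge2E.
rewrite /pullback /= !(nbhs_singleton Ps) tangentf_sum -big_split -sumrB /=.
apply: eq_bigr => x _; rewrite (eq_bigr _ (fun w _ => schouten21E x w _ m)).
rewrite !(big_split, sumrB) /= -!mulr_suml !sumrN -!mulr_suml !brt.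
rewrite !wedge2E /pair_arg /= !(lie _ _ _ Lxi) !(lie _ _ _ Leta) !iDE.
rewrite tangentfB !tangent_leibniz /= !iDE; ring.
Qed.

(** Skew-symmetry on decomposables; it brings the second term of the compatibility condition under
    [schouten21_formula]. *)
Lemma schouten12_21 (P : kform (dual A) 2) (x : sect A) (S : kform (dual A) 2) :
  is_schouten LA (p := 0) (q := 1) (sect_kform x) P S ->
  is_schouten LA (p := 1) (q := 0) P (sect_kform x) (fun xi => - S xi).
Proof.
move=> HS m; have [s [t [xs Pt HSm]]] := HS m; exists t, s; split=> // xi.
rewrite smoothfunNE HSm exchange_big -sumrN /=; apply: eq_bigr => y _.
by rewrite -sumrN; apply: eq_bigr => z _; rewrite schouten12E opprK.
Qed.

End HomLieDerivative.

(** * The Hom-Poisson bracket on functions *)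

Section BialgebroidPoisson.
Context {R : realType} {n : nat} {M : manifold R n} {r : nat}.
Context {A : vbundle M r} {phi : diffeo M}.
Context {phiA : inv_hom_bundle A phi} {phiAd : inv_hom_bundle (dual A) phi}.
Variables (LA : hom_lie_algebroid phiA) (LAd : hom_lie_algebroid phiAd).
Local Notation F := (pullback phi).
Local Notation G := (pullback (diffeo_inv phi)).
Local Notation iA := (ihb_inv phiA).
Local Notation iD := (ihb_inv phiAd).
Local Notation brA := (bracket LA).
Local Notation brD := (bracket LAd).
Local Notation a x := (act (bmap_sect (anchor LA) x)).
Local Notation b xi := (act (bmap_sect (anchor LAd) xi)).
Local Notation dstar := (dstar LAd).
Local Notation is_lie := (is_lie (phiAd := phiAd) LA).

Section EvalForm.
Variables (p : M) (f : C^oo(M)).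
Definition eval_form (v : tangent p) : R^o := v f.
Let eval_form_linear : linear eval_form.
Proof. by []. Qed.
HB.instance Definition _ :=
  GRing.isLinear.Build R (tangent p) R^o _ eval_form eval_form_linear.
End EvalForm.

Lemma eval_form_smooth f :
  dual_smooth (E := ptan phi) (fun m => (eval_form (p := phi m) f : {linear _ -> R^o})).
Proof. by move=> x; exact: (sectP x f). Qed.

(* df, as a section of phi^! T^*M *)
Definition dfun f : sect (dual (ptan phi)) := Sect (E := dual (ptan phi)) (eval_form_smooth f).

Lemma dual_anchor_dualE m (xi : dual (ptan phi) m) (eta : dual A m) :
  (eta : {linear A m -> R^o}) (dual_anchor_dual LAd m xi)
  = (xi : {linear _ -> R^o}) (anchor LAd m eta).
Proof. by rewrite /dual_anchor_dual /= bidualE. Qed.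

Lemma dual_anchor_dual_smooth (xi : sect (dual (ptan phi))) :
  vbundle_smooth (A := A) (fun m => dual_anchor_dual LAd m (xi m)).
Proof.
apply: (bidual_smooth (L := fun m => transpose (anchor LAd m) (xi m))) => eta.
exact: (sectP xi (bmap_sect (anchor LAd) eta)).
Qed.

Definition coanchor_dual (xi : sect (dual (ptan phi))) : sect A :=
  Sect (E := A) (dual_anchor_dual_smooth xi).

Lemma dual_anchor_smooth (xi : sect (dual (ptan phi))) :
  dual_smooth (E := A) (fun m => dual_anchor LA m (xi m)).
Proof. by move=> x; exact: (sectP xi (bmap_sect (anchor LA) x)). Qed.

(* d_* f *)
Definition dstf f := coanchor_dual (dfun f).
(* d f *)
Definition ddf f : sect (dual A) := Sect (E := dual A) (dual_anchor_smooth (dfun f)).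

Lemma pair_dstf xi f : pair xi (dstf f) = b xi f.
Proof. by apply: smoothfun_eq => m; rewrite actE /= dual_anchor_dualE. Qed.
Lemma pair_ddf f x : pair (ddf f) x = a x f.
Proof. exact: smoothfun_eq. Qed.

Lemma pair_eq (x y : sect A) : (forall xi, pair xi x = pair xi y) -> x = y.
Proof.
move=> xy; apply: sect_eq => m; apply: dual_separates => xi.
exact: (congr1 (fun f : C^oo(M) => f m) (xy xi)).
Qed.

Hypothesis hr : r <> 1%N.
Hypothesis hA : hom_lie_bialgebroid LA LAd.
Let hdag := hlb_dagger hA.
Local Notation pair_iD := (pair_iD hdag).

Lemma pair_hb xi x : pair (phiAd xi) (phiA x) = F (pair xi x).
Proof. by rewrite hdag ihbK. Qed.

Lemma hb_dstf f : phiA (dstf f) = dstf (F f).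
Proof.
apply: pair_eq => xi; rewrite -pair_iD !pair_dstf -anchor_hb.
by rewrite ihb_invK.
Qed.

Lemma iD_bracket xi eta : iD (brD xi eta) = brD (iD xi) (iD eta).
Proof.
apply: (can_inj (ihbK phiAd)).
by rewrite (hla_morph (bracket_hom_lie LAd)) !ihb_invK.
Qed.

(** * Calculus of the differential [d_*] and the compatibility condition *)

Lemma dstar_skew x xi eta : dstar x eta xi = - dstar x xi eta.
Proof.
rewrite !dstarE (hla_skew (bracket_hom_lie LAd) (iD eta)) -iD_bracket.
have -> : pair (iD (- iD (brD xi eta))) x = - pair (iD (iD (brD xi eta))) x.
  apply/eqP; rewrite -addr_eq0 -pairDl -ihb_invD addNr.
  rewrite -[X in iD X](scale0r (0 : sect (dual A))) [_ *: _]/(_ *s _) ihb_invZ pairZl.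
  by apply/eqP/smoothfun_eq => m; rewrite !smoothfunE /= mul0r.
rewrite pullbackN; by apply: smoothfun_eq => m; rewrite !smoothfunE; ring.
Qed.

Lemma dstarD x y xi eta : dstar (x + y) xi eta = dstar x xi eta + dstar y xi eta.
Proof.
rewrite !dstarE !pairDr !actfD pullbackD.
by apply: smoothfun_eq => m; rewrite !smoothfunE; ring.
Qed.

(** The correction term is [d_* f /\ phi_A(x)], because [b xi f] is the pairing of [xi] with
    [dstf f]. *)
Lemma dstarZ f x xi eta : dstar (f *s x) xi eta = F f * dstar x xi eta
  + (b xi f * pair eta (phiA x) - b eta f * pair xi (phiA x)).
Proof.
rewrite !dstarE !pairZr !act_leibniz pullbackM !pair_iD.
by apply: smoothfun_eq => m; rewrite !smoothfunE; ring.
Qed.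

Lemma dstarDl x xi xi' eta : dstar x (xi + xi') eta = dstar x xi eta + dstar x xi' eta.
Proof.
rewrite !dstarE ihb_invD brDl ihb_invD !pairDl anchorD actfD pullbackD.
by apply: smoothfun_eq => m; rewrite !smoothfunE; ring.
Qed.

Lemma dstarZl x f xi eta : dstar x (f *s xi) eta = f * dstar x xi eta.
Proof.
rewrite !dstarE ihb_invZ anchorZ pairZl act_leibniz pullback_invK br_leibl.
rewrite !ihb_invK pullback_invK ihb_invB !ihb_invZ pairBl !pairZl pullbackB.
rewrite !pullbackM !pullback_invK.
by apply: smoothfun_eq => m; rewrite !smoothfunE; ring.
Qed.

Lemma dstarDr x xi eta eta' : dstar x xi (eta + eta') = dstar x xi eta + dstar x xi eta'.
Proof. by rewrite dstar_skew dstarDl opprD -!(dstar_skew x _ xi). Qed.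
Lemma dstarZr x f xi eta : dstar x xi (f *s eta) = f * dstar x xi eta.
Proof. by rewrite dstar_skew dstarZl -mulrN -dstar_skew. Qed.

Lemma dstar_hb x xi eta : dstar (phiA x) xi eta = F (dstar x (iD xi) (iD eta)).
Proof.
rewrite !dstarE -!iD_bracket -!pair_iD !pullbackB -!anchor_hb !ihb_invK.
by [].
Qed.

(** The square of [d_*] vanishes on functions because the anchor of [A^*] is a representation. *)
Lemma dstar_dstf f xi eta : dstar (dstf f) xi eta = 0.
Proof.
rewrite dstarE !pair_dstf -anchor_hb ihb_invK anchor_bracket !ihb_invK.
by apply: smoothfun_eq => m; rewrite !smoothfunE; ring.
Qed.

(** The bialgebroid condition with both Schouten brackets in intrinsic form: no local decomposition
    remains. *)
Lemma dstar_bracket x y xi eta t1 t2 r1 r2 :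
  is_lie (phiA y) xi t1 -> is_lie (phiA y) eta t2 ->
  is_lie (phiA x) xi r1 -> is_lie (phiA x) eta r2 ->
  dstar (brA x y) xi eta =
    (F (dstar x t1 (iD eta)) + F (dstar x (iD xi) t2)
     - a (phiA (phiA y)) (dstar x (iD xi) (iD eta)))
  - (F (dstar y r1 (iD eta)) + F (dstar y (iD xi) r2)
     - a (phiA (phiA x)) (dstar y (iD xi) (iD eta))).
Proof.
move=> L1 L2 L3 L4; have [S [T [HS HT ST]]] := hlb_compat hA x y.
rewrite /dstar -!lock ST (schouten21_formula hdag HS L1 L2) -[T _]opprK.
congr (_ - _).
exact: (schouten21_formula hdag (schouten12_21 HT) L3 L4).
Qed.

(** Twisted form of [L_(f y) xi = f L_y xi + <xi, y> df]. *)
Lemma is_lie_fscale f y xi t : is_lie (phiA y) xi t ->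
  is_lie (phiA (f *s y)) xi
    (F f *s t + G (pair xi (phiA (phiA y))) *s ddf f).
Proof.
move=> L x; rewrite pairDl !pairZl pair_ddf pullbackD !pullbackM L pullback_invK.
rewrite !hb_semilinear bracket_leibniz pairDr !pairZr anchorZ anchor_hb.
by apply: smoothfun_eq => m; rewrite !smoothfunE; ring.
Qed.

(* The defect of d_*(a(phi x) f) = [phi x, d_* f] + phi(d_* x(-, df)). *)
Definition defect x f xi : C^oo(M) := b xi (a (phiA x) f)
  + pair xi (brA (dstf f) (phiA x)) - F (dstar x (iD xi) (ddf f)).

(* Compare the compatibility condition for (x, f y) with the one for (x, y). *)
Lemma defect_wedge x f xi eta y :
  defect x f xi * pair eta (phiA (phiA y))
  = pair xi (phiA (phiA y)) * defect x f eta.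
Proof.
have [t1 L1] := is_lie_exists LA hdag (phiA y) xi.
have [t2 L2] := is_lie_exists LA hdag (phiA y) eta.
have [r1 L3] := is_lie_exists LA hdag (phiA x) xi.
have [r2 L4] := is_lie_exists LA hdag (phiA x) eta.
have := dstar_bracket (is_lie_fscale f L1) (is_lie_fscale f L2) L3 L4.
rewrite bracket_leibniz dstarD !dstarZ (dstar_bracket L1 L2 L3 L4).
rewrite dstar_hb (hla_morph (bracket_hom_lie LA)).
rewrite dstarDl dstarDr !dstarZl !dstarZr !hb_semilinear anchorZ.
rewrite !(pullbackD, pullbackN, pullbackM, actfD, actfN, act_leibniz, pullback_invK).
(* [b r1 f] is the pairing of [r1] with [dstf f], so [L3] computes it; this produces the bracket
   term of [defect]. Likewise for [r2]. *)
rewrite -!(pair_dstf r1) -!(pair_dstf r2) !L3 !L4 !pair_iD !anchor_hb !pair_dstf.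
have bE z : F (b (iD z) f) = b z (F f) by rewrite -anchor_hb ihb_invK.
have skew z : pair z (brA (phiA y) (phiA x)) = - pair z (brA (phiA x) (phiA y)).
  apply: smoothfun_eq => m; rewrite smoothfunE /=.
  by rewrite (hla_skew (bracket_hom_lie LA)) /= linearN.
rewrite !bE !skew /defect (dstar_skew x (iD eta) (ddf f)) pullbackN.
move=> H; apply: smoothfun_eq => m.
have {H} := congr1 (fun f : C^oo(M) => f m) H.
rewrite !smoothfunE => /eqP; rewrite -subr_eq0 => /eqP H.
by apply/eqP; rewrite -subr_eq0 -[X in _ == X]H; apply/eqP; ring.
Qed.

Lemma defectD x f xi eta : defect x f (xi + eta) = defect x f xi + defect x f eta.
Proof.
rewrite /defect anchorD pairDl ihb_invD dstarDl pullbackD.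
by apply: smoothfun_eq => m; rewrite !smoothfunE; ring.
Qed.

Lemma defectZ x f g xi : defect x f (g *s xi) = g * defect x f xi.
Proof.
rewrite /defect anchorZ pairZl ihb_invZ dstarZl pullbackM pullback_invK.
by apply: smoothfun_eq => m; rewrite !smoothfunE; ring.
Qed.

(* Contracting [defect_wedge] over a frame of A gives r * defect = defect. *)
Lemma defect0 x f xi : defect x f xi = 0.
Proof.
apply: smoothfun_eq => m; rewrite smoothfunE.
have [chi [e [eps [/nbhs_singleton chi1 He tr]]]] := vbundle_frame A m.
have Hxi : chi *s xi = \sum_i pair xi (e i) *s eps i.
  apply: sect_eq => q; rewrite sect_sumE; apply: linear_ext => v.
  have := congr1 (xi q) (He q v); rewrite linearZ linear_sum lform_sumE /= => ->.
  by apply: eq_bigr => i _; rewrite linearZ; exact: mulrC.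
have E : r%:R * defect x f xi m = defect x f xi m.
  have cd : chi m * defect x f xi m = defect x f xi m by rewrite chi1 mul1r.
  rewrite -[RHS]cd -smoothfunME -defectZ Hxi.
  rewrite (sect_addr_sum (defectD x f)) smoothfun_sumE.
  have -> : r%:R = \sum_i (eps i m (e i m) : R) by rewrite tr chi1 mulr1.
  rewrite mulr_suml; apply: eq_bigr => i _.
  rewrite defectZ smoothfunME.
  (* [defect_wedge] sees [y] through the square of [phi_A], hence the double inverse. *)
  have := defect_wedge x f xi (eps i) (iA (iA (e i))); rewrite !ihb_invK.
  by move=> /(congr1 (fun f : C^oo(M) => f m)); rewrite !smoothfunME mulrC.
apply/eqP; move/eqP: E; rewrite -subr_eq0 -{2}[defect _ _ _ _]mul1r -mulrBl mulf_eq0.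
by rewrite subr_eq0 (eqr_nat R r 1) => /orP[/eqP/hr|].
Qed.

(** * The bracket [P f g] of functions: skew-symmetry, Jacobi identity, invariance *)

Local Notation P f g := (a (dstf f) g).

(* Compare [defect0] for g x with the one for x. *)
Lemma poisson_skew f g : P f g = - P g f.
Proof.
have H x eta : F (P f g + P g f) * pair eta (phiA (phiA x)) = 0.
  have := defect0 (g *s x) f eta; have := defect0 x f eta.
  rewrite /defect hb_semilinear anchorZ act_leibniz bracket_leibniz pairDr !pairZr.
  rewrite dstarZ !pullbackD !pullbackM !anchor_hb pullbackN pullbackM !pair_iD.
  (* [b (ddf f) g] is the pairing of [d f] with [d_* g], that is [P g f]: the two orders of the
     bracket meet here. *)
  rewrite pair_ddf -(pair_dstf (ddf f)) !pair_ddf -pair_iD.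
  have -> : F (b (iD eta) g) = b eta (F g) by rewrite -anchor_hb ihb_invK.
  move=> H0 H1; apply: smoothfun_eq => m.
  have := congr1 (fun f : C^oo(M) => f m) H0.
  have := congr1 (fun f : C^oo(M) => f m) H1.
  rewrite !smoothfunE => E1 /eqP; rewrite subr_eq0 => /eqP E0.
  by rewrite -[RHS]E1 -E0; ring.
(* [x] and [eta] are built from [d_* h] and [d k], making the other factor a bracket. So
   [P f g + P g f] kills all brackets, hence itself, and its square is 0. *)
have H2 h k : F (P f g + P g f) * F (P h k) = 0.
  have := H (iA (iA (phiA (dstf h)))) (phiAd (ddf k)).
  by rewrite !ihb_invK pair_hb pair_ddf.
apply: smoothfun_eq => m; rewrite smoothfunNE; apply/eqP; rewrite -addr_eq0.
have : F ((P f g + P g f) * (P f g + P g f)) = 0.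
  by rewrite pullbackM [X in _ * X]pullbackD mulrDr !H2 addr0.
rewrite -(pullback0 phi) => /pullback_inj /(congr1 (fun f : C^oo(M) => f m)).
by rewrite smoothfunME smoothfun0E => /eqP; rewrite mulf_eq0 orbb.
Qed.

Lemma poisson_bracket_hom f g : dstf (P f g) = brA (dstf f) (dstf g).
Proof.
(* [defect] applies [phi_A] to its first argument, so [f] is written as a pullback of [h]; for
   [x = d_* h] the term in [d_* x] drops out. *)
rewrite -[f](pullback_invK phi) -hb_dstf; set h := G f.
apply: pair_eq => eta; rewrite pair_dstf.
have := defect0 (dstf h) g eta.
rewrite /defect dstar_dstf pullback0 subr0 => /eqP; rewrite addr_eq0 => /eqP ->.
rewrite (hla_skew (bracket_hom_lie LA)); apply: smoothfun_eq => m.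
by rewrite smoothfunNE /= linearN opprK.
Qed.

(** The anchor of [A], a representation, turns [[d_* f, d_* g]] into a twisted commutator. *)
Lemma poisson_jacobi f g h :
  P (P f g) (F h) = P (F f) (P g h) - P (F g) (P f h).
Proof. by rewrite poisson_bracket_hom anchor_bracket !hb_dstf. Qed.

Lemma poisson_invariant f g : P (F f) (F g) = F (P f g).
Proof. by rewrite -hb_dstf anchor_hb. Qed.

(** The cyclic form, untwisted by [G], is the shape of the Jacobiator in [schouten_biv]. *)
Lemma poisson_jacobi_cyclic f g h :
  P (G (P f g)) h + P (G (P g h)) f + P (G (P h f)) g = 0.
Proof.
apply: (@pullback_inj _ _ _ phi).
rewrite pullback0 !pullbackD -!poisson_invariant !pullback_invK.
rewrite poisson_jacobi (poisson_skew (P g h)) (poisson_skew (P h f)).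
rewrite (poisson_skew h f) actfN.
by apply: smoothfun_eq => m; rewrite !smoothfunE; ring.
Qed.

Lemma anchor_ddf f g : b (ddf f) g = - P f g.
Proof. by rewrite poisson_skew -pair_dstf pair_ddf opprK. Qed.

End BialgebroidPoisson.

(** * The Hom-Poisson tensor *)

Section PoissonSchouten.
Context {R : realType} {n : nat} {M : manifold R n} {phi : diffeo M}.
Local Notation F := (pullback phi).
Local Notation G := (pullback (diffeo_inv phi)).
Local Notation T := (ptan phi).

Definition biv (x : 'I_2 -> sect T) (f g : C^oo(M)) : C^oo(M) :=
  act (x ord0) f * act (x ord_max) g - act (x ord_max) f * act (x ord0) g.

(* Up to sign, the Hom-Schouten bracket of two bivectors is their polarised
   Jacobiator. *)
Lemma schouten_biv (x y : 'I_2 -> sect T) (xi : 'I_3 -> sect (dual T)) (m : M)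
    (f g h : C^oo(M)) :
  (forall k l, let v := ptan_bracket (x k) (y l) in
    [/\ xi (inord 0) m (v m) = act v f m, xi (inord 1) m (v m) = act v g m
      & xi (inord 2) m (v m) = act v h m]) ->
  (forall k, let v := Ad (x k) in
    [/\ xi (inord 0) m (v m) = act v f m, xi (inord 1) m (v m) = act v g m
      & xi (inord 2) m (v m) = act v h m]) ->
  (forall k, let v := Ad (y k) in
    [/\ xi (inord 0) m (v m) = act v f m, xi (inord 1) m (v m) = act v g m
      & xi (inord 2) m (v m) = act v h m]) ->
  let J f g h := biv x (G (biv y f g)) h + biv y (G (biv x f g)) h in
  schouten_decomposable (ptan_algebroid phi) (p := 1) (q := 1) x y xi m
  = - (J (G f) (G g) (G h) + J (G g) (G h) (G f) + J (G h) (G f) (G g)) (phi m).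
Proof.
move=> Hbr Hx Hy J; rewrite /J /biv.
rewrite !pullbackB !pullbackM !actfB !act_leibniz !pullback_invK !smoothfunE.
rewrite /schouten_decomposable !big_ord_recl !big_ord0 !enum_I2 !lift01 /= !wedge3E.
rewrite !inordK //=.
have [X000 X001 X002] := Hbr ord0 ord0.
have [X010 X011 X012] := Hbr ord0 ord_max.
have [X100 X101 X102] := Hbr ord_max ord0.
have [X110 X111 X112] := Hbr ord_max ord_max.
have [Y00 Y01 Y02] := Hx ord0; have [Y10 Y11 Y12] := Hx ord_max.
have [Z00 Z01 Z02] := Hy ord0; have [Z10 Z11 Z12] := Hy ord_max.
rewrite X000 X001 X002 X010 X011 X012 X100 X101 X102 X110 X111 X112.
rewrite Y00 Y01 Y02 Y10 Y11 Y12 Z00 Z01 Z02 Z10 Z11 Z12.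
(* [ptan_bracket] and [Ad] apply [F] last, so only derivatives at [phi m] remain. *)
rewrite !act_bracket !act_Ad !smoothfunE !pullbackE !actE; ring.
Qed.

End PoissonSchouten.

(** * The bivector [pi]: skew-symmetry, invariance and Schouten square *)

Section HomPoisson.
Context {R : realType} {n : nat} {M : manifold R n} {r : nat}.
Context {A : vbundle M r} {phi : diffeo M}.
Context {phiA : inv_hom_bundle A phi} {phiAd : inv_hom_bundle (dual A) phi}.
Variables (LA : hom_lie_algebroid phiA) (LAd : hom_lie_algebroid phiAd).
Hypothesis hr : r <> 1%N.
Hypothesis hA : hom_lie_bialgebroid LA LAd.
Local Notation F := (pullback phi).
Local Notation G := (pullback (diffeo_inv phi)).
Local Notation a x := (act (bmap_sect (anchor LA) x)).
Local Notation b xi := (act (bmap_sect (anchor LAd) xi)).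
Local Notation P f g := (a (dstf LAd f) g).
Local Notation T := (ptan phi).

(** The images of both anchors at [m] are spanned by those of a frame and a coframe, so one function
    represents [xi] on them and on [w] at once. *)
Lemma covector_eval_anchors (m : M) (xi : dual T m) (I : finType) (w : I -> T m) :
  exists f : C^oo(M),
  [/\ forall i, (xi : {linear _ -> R^o}) (w i) = (w i : tangent _) f,
      forall v : A m, (xi : {linear _ -> R^o}) (anchor LA m v) = (anchor LA m v : tangent _) f
    & forall ze : dual A m,
        (xi : {linear _ -> R^o}) (anchor LAd m ze) = (anchor LAd m ze : tangent _) f].
Proof.
have [chi [e [eps [/nbhs_singleton chi1 He _]]]] := vbundle_frame A m.
pose u (i : I + ('I_r + 'I_r)) : tangent (phi m) := match i with
  | inl j => w j
  | inr (inl j) => anchor LA m (e j m)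
  | inr (inr j) => anchor LAd m (eps j m)
  end.
have [f Hf] := covector_eval u xi.
have tsum (c : 'I_r -> R) (v : 'I_r -> tangent (phi m)) :
    (\sum_i c i *: v i : tangent (phi m)) f = \sum_i c i * v i f.
  by rewrite (big_morph (fun v : tangent (phi m) => v f) (fun _ _ => erefl) erefl).
exists f; split=> [i|v|ze]; first exact: (Hf (inl i)).
  have -> : v = \sum_i (eps i m v : R) *: e i m by rewrite -He chi1 scale1r.
  rewrite !linear_sum (eq_bigr (fun i => (eps i m v : R) *: anchor LA m (e i m))).
    rewrite tsum; apply: eq_bigr => i _.
    by rewrite linearZ linearZ -(Hf (inr (inl i))).
  by move=> i _; rewrite linearZ.
pose c i : R := (ze : {linear A m -> R^o}) (e i m).
have -> : ze = \sum_i c i *: (eps i m : dual A m).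
  apply: linear_ext => v; rewrite lform_sumE.
  rewrite -[v in LHS]scale1r -chi1 He linear_sum; apply: eq_bigr => i _.
  by rewrite linearZ; exact: mulrC.
rewrite !linear_sum (eq_bigr (fun i => c i *: anchor LAd m (eps i m))).
  rewrite tsum; apply: eq_bigr => i _.
  by rewrite linearZ linearZ -(Hf (inr (inr i))).
by move=> i _; rewrite linearZ.
Qed.

Lemma pi_sharp_eval (m : M) (xi : dual T m) (f : C^oo(M)) :
  (forall ze : dual A m,
    (xi : {linear _ -> R^o}) (anchor LAd m ze) = (anchor LAd m ze : tangent _) f) ->
  pi_sharp LA LAd m xi = bmap_sect (anchor LA) (dstf LAd f) m.
Proof.
move=> Hf; congr (anchor LA m _); apply: dual_separates => ze.
by rewrite !dual_anchor_dualE Hf.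
Qed.

Lemma pi_bar_sharp_opp (m : M) (xi : dual T m) :
  pi_bar_sharp LA LAd m xi = - pi_sharp LA LAd m xi.
Proof.
have [f [_ Hv Hze]] := covector_eval_anchors xi (fun i : void => of_void _ i).
rewrite (pi_sharp_eval Hze).
have -> : pi_bar_sharp LA LAd m xi = bmap_sect (anchor LAd) (ddf LA f) m.
  by congr (anchor LAd m _); apply: linear_ext => v; exact: Hv.
apply: tangent_eq => h; rewrite tangentNE -!actE -smoothfunNE.
by rewrite (anchor_ddf hr hA).
Qed.

Lemma pi_sharp_skew (m : M) (xi eta : dual T m) :
  (eta : {linear _ -> R^o}) (pi_sharp LA LAd m xi)
  = - (xi : {linear _ -> R^o}) (pi_sharp LA LAd m eta).
Proof.
have [f [_ Hv Hze]] := covector_eval_anchors xi (fun i : void => of_void _ i).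
have [g [_ Hv' Hze']] := covector_eval_anchors eta (fun i : void => of_void _ i).
rewrite (pi_sharp_eval Hze) (pi_sharp_eval Hze') /= Hv Hv'.
rewrite -[LHS](actE (bmap_sect (anchor LA) (dstf LAd f))).
rewrite -[X in - X](actE (bmap_sect (anchor LA) (dstf LAd g))).
by rewrite (poisson_skew hr hA).
Qed.

(* c = 1 gives pi, and c = -1 gives the form of pi_bar_sharp. *)
Variable c : R.

Definition poisson_form : kform (dual T) 2 := fun xi =>
  c *: pair (xi ord_max) (bmap_sect (anchor LA) (coanchor_dual LAd (xi ord0))).

Lemma poisson_formE xi m : poisson_form xi m
  = c * ((xi ord_max m : {linear _ -> R^o}) (pi_sharp LA LAd m (xi ord0 m))).
Proof. by []. Qed.

Lemma poisson_form_eval (xi : 'I_2 -> sect (dual T)) (m : M) (f g : C^oo(M)) :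
  (forall ze : dual A m,
    (xi ord0 m : {linear _ -> R^o}) (anchor LAd m ze) = (anchor LAd m ze : tangent _) f) ->
  (forall v : A m,
    (xi ord_max m : {linear _ -> R^o}) (anchor LA m v) = (anchor LA m v : tangent _) g) ->
  poisson_form xi m = c * P f g m.
Proof. by move=> Hze Hv; rewrite poisson_formE (pi_sharp_eval Hze) /= Hv. Qed.

Lemma poisson_form_is_kform : is_kform poisson_form.
Proof.
split=> [X i f x y|X i j ij Xij]; apply: smoothfun_eq => m.
  rewrite smoothfunDE smoothfunME !poisson_formE /subst_arg.
  have [->|i0] := eqVneq i ord0.
    have -> : (ord_max == ord0 :> 'I_2) = false by [].
    rewrite -[(f *s x + y) m]/(f m *: x m + y m) !linearD !linearZ /=.
    by rewrite mulrDr mulrCA.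
  have -> : i = ord_max.
    by apply/val_inj; case: i i0 => -[|[|]]//= ? /eqP[]; exact/val_inj.
  rewrite eqxx -[(f *s x + y) m]/((f m *: x m + y m : {linear _ -> R^o})).
  by rewrite lformDE lformZE mulrDr mulrCA.
rewrite poisson_formE smoothfunE.
have -> : X ord_max = X ord0.
  have cases (k : 'I_2) : k = ord0 \/ k = ord_max.
    by case: k => -[|[|]]//= ?; [left|right]; exact/val_inj.
  have [i0|i0] := cases i; have [j0|j0] := cases j; subst i j => //.
have := pi_sharp_skew (X ord0 m) (X ord0 m) => /eqP.
by rewrite -addr_eq0 -mulr2n mulrn_eq0 /= => /eqP ->; rewrite mulr0.
Qed.

(* [pi = 1/2 sum_i a_(A^* )(eps_i) /\ a_A(e_i)] by skew-symmetry: no chart of M is needed. *)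
Lemma poisson_form_local (p : M) : exists X : 'I_r -> 'I_2 -> sect T,
  locally_sum poisson_form p [seq X i | i <- enum 'I_r].
Proof.
have [chi [e [eps [chi1 He _]]]] := vbundle_frame A p.
exists (fun i => pair_arg ((c / 2) *: bmap_sect (anchor LAd) (eps i))
                          (bmap_sect (anchor LA) (e i))).
near=> q; move=> xi.
have chiq : chi q = 1 by near: q.
have sharpE (ze : dual T q) :
    pi_sharp LA LAd q ze
    = \sum_i ((ze : {linear _ -> R^o}) (anchor LAd q (eps i q)) : R) *: anchor LA q (e i q).
  rewrite -[LHS]/(anchor LA q (dual_anchor_dual LAd q ze)).
  rewrite -[dual_anchor_dual LAd q ze]scale1r -chiq He linear_sum.
  by apply: eq_bigr => i _; rewrite linearZ dual_anchor_dualE.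
rewrite big_map big_enum poisson_formE /=.
set x0 := xi ord0 q; set x1 := xi ord_max q.
have -> : (x1 : {linear _ -> R^o}) (pi_sharp LA LAd q x0)
    = (2^-1 : R) * (((x1 : {linear _ -> R^o}) (pi_sharp LA LAd q x0) : R)
      - (x0 : {linear _ -> R^o}) (pi_sharp LA LAd q x1)).
  by rewrite -pi_sharp_skew; field.
rewrite !sharpE (linear_sum (x1 : {linear _ -> R^o})).
rewrite (linear_sum (x0 : {linear _ -> R^o})) -sumrB !mulr_sumr.
apply: eq_bigr => i _.
rewrite wedge2E /pair_arg /= -/x0 -/x1.
by rewrite !(lformZr (x0 : {linear _ -> R^o})) !(lformZr (x1 : {linear _ -> R^o})); field.
Unshelve. all: by end_near. Qed.

Lemma wedge_dfun (x : 'I_2 -> sect T) f g q :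
  wedge x (pair_arg (dfun f) (dfun g)) q = biv x f g q.
Proof. by rewrite wedge2E. Qed.

Lemma poisson_form_dfun f g q :
  poisson_form (pair_arg (dfun f) (dfun g)) q = c * P f g q.
Proof. exact: poisson_form_eval. Qed.

Lemma poisson_form_biv p (X : 'I_r -> 'I_2 -> sect T) f g :
  locally_sum poisson_form p [seq X i | i <- enum 'I_r] ->
  \forall q \near p, c * P f g q = \sum_i biv (X i) f g q.
Proof.
apply: filterS => q Hq; rewrite -poisson_form_dfun Hq big_map big_enum.
by apply: eq_bigr => i _; exact: wedge_dfun.
Qed.

(** Reduces to [poisson_invariant], for functions that also represent the covectors on the vectors
    [Ad (X i k)]. *)
Lemma poisson_form_invariant : is_extension (ptan_inv_hom phi) poisson_form poisson_form.
Proof.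
move=> m; have [X HX] := poisson_form_local (phi m).
exists [seq X i | i <- enum 'I_r] => // xi.
pose w (i : 'I_r * 'I_2) : T m := Ad (X i.1 i.2) m.
have [f [Hf _ Hze]] := covector_eval_anchors (xi ord0 m) w.
have [g [Hg Hv _]] := covector_eval_anchors (xi ord_max m) w.
rewrite (poisson_form_eval Hze Hv) big_map big_enum.
rewrite -[f in LHS](pullback_invK phi) -[g in LHS](pullback_invK phi).
rewrite (poisson_invariant hA) pullbackE.
rewrite (nbhs_singleton (poisson_form_biv (G f) (G g) HX)).
apply: eq_bigr => i _; rewrite wedge2E /biv !smoothfunE.
have E0 k : (xi ord0 m : {linear _ -> R^o}) (Ad (X i k) m) = act (X i k) (G f) (phi m).
  by rewrite -pullbackE -act_Ad; exact: (Hf (i, k)).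
have E1 k : (xi ord_max m : {linear _ -> R^o}) (Ad (X i k) m) = act (X i k) (G g) (phi m).
  by rewrite -pullbackE -act_Ad; exact: (Hg (i, k)).
by rewrite -!E0 -!E1.
Qed.

Lemma bivDl (x : 'I_2 -> sect T) (I : Type) (s : seq I) (k : I -> C^oo(M)) h m :
  biv x (\sum_(i <- s) k i) h m = \sum_(i <- s) biv x (k i) h m.
Proof.
rewrite /biv !smoothfunE !actE !tangentf_sum !mulr_suml -sumrB.
by apply: eq_bigr => i _; rewrite !smoothfunE !actE.
Qed.

Lemma poisson_form_biv2 m (X : 'I_r -> 'I_2 -> sect T) f g h :
  locally_sum poisson_form (phi m) [seq X i | i <- enum 'I_r] ->
  \sum_i \sum_j biv (X i) (G (biv (X j) f g)) h (phi m)
  = c * (c * P (G (P f g)) h (phi m)).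
Proof.
move=> HX.
have E (x : 'I_2 -> sect T) :
    \sum_j biv x (G (biv (X j) f g)) h (phi m) = biv x (c *: G (P f g)) h (phi m).
  rewrite -bivDl -pullback_sum -pullbackZ /biv !smoothfunE !actE.
  suff L (v : tangent (phi (phi m))) :
    v (G (\sum_i biv (X i) f g)) = v (G (c *: P f g)) by rewrite !L.
  apply: tangent_local.
  have := poisson_form_biv f g HX.
  (* The decomposition holds near [phi m] but [v] is tangent at [phi (phi m)]; the inverse of [phi],
     through [G], relates the neighbourhoods. *)
  rewrite -{1}[phi m](diffeoK phi) => N.
  have /= N2 := @smoothmap_cts _ _ _ _ _ (diffeo_inv phi) (phi (phi m)) _ N.
  apply: (@filterS _ (nbhs (phi (phi m))) _ _ _ _ N2) => q /= Hq.
  by rewrite smoothfun_sumE -Hq.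
rewrite (eq_bigr _ (fun i _ => E (X i))).
rewrite -(nbhs_singleton (poisson_form_biv (c *: G (P f g)) h HX)); congr (_ * _).
(* Skew-symmetry moves the scalar to the second slot, where a tangent vector acts linearly. *)
rewrite !(poisson_skew hr hA _ h) !smoothfunNE !actE tangentfZ.
by rewrite mulrN.
Qed.

(** With the three covectors at [m] represented by functions, the bracket is minus twice [c^2] times
    the Jacobiator of [P]. *)
Lemma poisson_form_schouten :
  is_schouten (ptan_algebroid phi) (p := 1) (q := 1) poisson_form poisson_form (fun=> 0).
Proof.
move=> m; have [X HX] := poisson_form_local (phi m).
exists [seq X i | i <- enum 'I_r], [seq X i | i <- enum 'I_r]; split=> // xi.
(* These are all the vectors at [m] on which the expanded Schouten bracket evaluates a covector. *)
pose w (i : ('I_r * 'I_2) * ('I_r * 'I_2) + 'I_r * 'I_2) : tangent (phi m) := match i with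
  | inl ij => ptan_bracket (X ij.1.1 ij.1.2) (X ij.2.1 ij.2.2) m
  | inr i => Ad (X i.1 i.2) m
  end.
have [f Hf] := covector_eval w (xi (inord 0) m).
have [g Hg] := covector_eval w (xi (inord 1) m).
have [h Hh] := covector_eval w (xi (inord 2) m).
have Hbr i j k l : let v := ptan_bracket (X i k) (X j l) in
    [/\ xi (inord 0) m (v m) = act v f m, xi (inord 1) m (v m) = act v g m
      & xi (inord 2) m (v m) = act v h m].
  by split; [have := Hf (inl ((i, k), (j, l))) | have := Hg (inl ((i, k), (j, l)))
            | have := Hh (inl ((i, k), (j, l)))].
have HAd i k : let v := Ad (X i k) in
    [/\ xi (inord 0) m (v m) = act v f m, xi (inord 1) m (v m) = act v g m
      & xi (inord 2) m (v m) = act v h m].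
  by split; [have := Hf (inr (i, k)) | have := Hg (inr (i, k)) | have := Hh (inr (i, k))].
pose K f g h := \sum_i \sum_j biv (X i) (G (biv (X j) f g)) h (phi m).
have -> : \sum_(x <- [seq X i | i <- enum 'I_r]) \sum_(y <- [seq X i | i <- enum 'I_r])
      schouten_decomposable (ptan_algebroid phi) (p := 1) (q := 1) x y xi m
    = - (2 * (K (G f) (G g) (G h) + K (G g) (G h) (G f) + K (G h) (G f) (G g))).
  rewrite big_map big_enum /=.
  (* Exchanging the indices identifies the two halves of the polarised Jacobiator, whence the factor
     2. *)
  have KC f' g' h' : K f' g' h' = \sum_i \sum_j biv (X j) (G (biv (X i) f' g')) h' (phi m).
    by rewrite /K exchange_big.
  rewrite mulr2n mulrDl mul1r {1}/K {1}/K {1}/K !KC -!big_split /= -sumrN.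
  apply: eq_bigr => i _; rewrite big_map big_enum /= -!big_split -sumrN.
  apply: eq_bigr => j _ /=.
  rewrite (schouten_biv (Hbr i j) (HAd i) (HAd j)) !smoothfunE !actE; ring.
rewrite /K !(poisson_form_biv2 _ _ _ HX) -!mulrDr -!smoothfunDE.
by rewrite (poisson_jacobi_cyclic hr hA) smoothfun0E !mulr0 oppr0.
Qed.

Lemma poisson_form_defines (pis : forall m, {linear dual T m -> T m}) :
  (forall m xi, pis m xi = c *: pi_sharp LA LAd m xi) -> defines_hom_poisson pis.
Proof.
move=> Hpis; exists poisson_form.
  by move=> xi m; rewrite Hpis poisson_formE (lformZr (xi ord_max m : {linear _ -> R^o})).
split; first exact: poisson_form_is_kform.
  exact: poisson_form_schouten.
exact: poisson_form_invariant.
Qed.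

End HomPoisson.

Theorem theorem4p6 (R : realType) (n : nat) (M : manifold R n) (r : nat)
    (A : vbundle M r) (phi : diffeo M)
    (phiA : inv_hom_bundle A phi) (phiAd : inv_hom_bundle (dual A) phi)
    (LA : hom_lie_algebroid phiA) (LAd : hom_lie_algebroid phiAd)
    (hr : r <> 1%N) (hA : hom_lie_bialgebroid LA LAd) :
  defines_hom_poisson (pi_sharp LA LAd) /\
  defines_hom_poisson (pi_bar_sharp LA LAd) /\
  (forall (m : M) (xi : dual (ptan phi) m),
     pi_bar_sharp LA LAd m xi = - pi_sharp LA LAd m xi).
Proof.
split; [|split].
- by apply: (poisson_form_defines hr hA (c := 1)) => m xi; rewrite scale1r.
- apply: (poisson_form_defines hr hA (c := -1)) => m xi.
  by rewrite scaleN1r (pi_bar_sharp_opp hr hA).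
- exact: pi_bar_sharp_opp.
Qed.
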